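(* Let $n\geq 6$ and consider the action of $\mathrm{Aut}(C_n)=D_n$ on $V(C_n)$ with $2$ colors. If $4\nmid n$ and $5\nmid n$, then $\mathrm{ext}_D(C_n)=4$. If $4\mid n$ and $5\nmid n$, then $\mathrm{ext}_D(C_n)=5$. If $5\mid n$, then $\mathrm{ext}_D(C_n)=6$. Moreover, for the action of $O(2)=\mathrm{Isom}(S^1)$ on the unit circle $S^1$ with $2$ colors, $\mathrm{ext}_D(S^1,O(2))=6$.
   Context: Let a group $\Gamma$ act faithfully on a set $X$. A coloring $c:X\to\{R,B\}$ is $\Gamma$-distinguishing if the only $\gamma\in\Gamma$ with $c\circ\gamma=c$ is the identity. For $W\subset X$ whose pointwise stabilizer in $\Gamma$ is trivial, the precoloring extension property $P(W)$ holds if every precoloring $c:X\setminus W\to\{R,B\}$ can be extended to a $\Gamma$-distinguishing coloring $X\to\{R,B\}$. The distinguishing extension number $\mathrm{ext}_D(X,\Gamma)$ is the smallest $m$ such that every $W\subset X$ with $|W|\geq m$ and trivial pointwise stabilizer in $\Gamma$ satisfies $P(W)$ (it is $\infty$ if no such $m$ exists). Here $C_n$ is the cycle graph on $n$ vertices, $\mathrm{ext}_D(C_n):=\mathrm{ext}_D(V(C_n),\mathrm{Aut}(C_n))$, and the number of colors is $2$ (the distinguishing number in all cases considered). *)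

(* Defs.v *)
From Stdlib Require Import Reals Arith List.
Import ListNotations.

(** Generic setting: a group Gamma acting faithfully on a set X, given
    concretely as a predicate on maps X -> X (the group elements, acting by
    application; faithfulness is automatic). *)
Section Ext.
Variable X : Type.
Variable Gamma : (X -> X) -> Prop.

Definition distinguishing (c : X -> bool) : Prop :=
  forall g, Gamma g -> (forall x, c (g x) = c x) -> forall x, g x = x.

Definition trivial_ptwise_stab (W : X -> Prop) : Prop :=
  forall g, Gamma g -> (forall x, W x -> g x = x) -> forall x, g x = x.

Definition precol_ext (W : X -> Prop) : Prop :=
  forall c0 : X -> bool,
    exists c : X -> bool,
      (forall x, ~ W x -> c x = c0 x) /\ distinguishing c.

(** |W| >= m  (W may be infinite): W contains m distinct elements. *)
Definition card_ge (W : X -> Prop) (m : nat) : Prop :=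
  exists l : list X, length l = m /\ NoDup l /\ Forall W l.

Definition ext_good (m : nat) : Prop :=
  forall W : X -> Prop, card_ge W m -> trivial_ptwise_stab W -> precol_ext W.

Definition ext_D_eq (m : nat) : Prop :=
  ext_good m /\ forall k, k < m -> ~ ext_good k.
End Ext.

Definition cyc_vert (n : nat) : Type := { k : nat | k < n }.

Definition cyc_adj (n : nat) (i j : cyc_vert n) : Prop :=
  proj1_sig j = (S (proj1_sig i)) mod n \/ proj1_sig i = (S (proj1_sig j)) mod n.

Definition cyc_aut (n : nat) (g : cyc_vert n -> cyc_vert n) : Prop :=
  (forall x y, g x = g y -> x = y) /\ (forall y, exists x, g x = y) /\
  (forall i j, cyc_adj n (g i) (g j) <-> cyc_adj n i j).

Definition S1 : Type := { p : R * R | (fst p) ^ 2 + (snd p) ^ 2 = 1 }%R.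

Definition S1_dist2 (p q : S1) : R :=
  let (a, _) := p in let (b, _) := q in
  ((fst a - fst b) ^ 2 + (snd a - snd b) ^ 2)%R.

Definition S1_isom (g : S1 -> S1) : Prop :=
  (forall p q, S1_dist2 (g p) (g q) = S1_dist2 p q) /\ (forall y, exists x, g x = y).

(* Main.v *)
Require Import Defs.
From Stdlib Require Import Reals Arith List ZArith Lia Lra Classical ClassicalEpsilon.
Import ListNotations.

(** Both actions are those of the maps [u -> u + s] and [u -> b - u] on an
    abelian group with at most one involution.  The heart of the proof is that
    a triple [x, y, z] none of whose points is fixed by a mirror swapping the
    other two (a "scalene" triple) already has the extension property: if all
    eight colourings of it were symmetric, one first excludes periods, so each
    colouring has exactly one mirror.  Composing the mirrors of two colourings
    that differ at one point gives a translation changing the colouring at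
    exactly two places, and for a monochromatic triple these translations force
    a point [h] after whose recolouring the colouring is periodic, which is again
    impossible; the only escape, a mirror through two antipodal points of the
    triple, cannot serve for both monochromatic colourings.

    It remains to note that a set without scalene triples with at least four
    elements is a square or consists of at least four vertices of a regular
    pentagon; these, and three consecutive points, are bad for a constant
    precolouring. *)

(** * Abelian groups and a linear-arithmetic tactic *)

Record abgroup := AbGroup {
  carrier :> Type;
  gzero : carrier;
  gadd : carrier -> carrier -> carrier;
  gopp : carrier -> carrier;
  gaddA : forall x y z, gadd x (gadd y z) = gadd (gadd x y) z;
  gaddC : forall x y, gadd x y = gadd y x;
  gadd0 : forall x, gadd x gzero = x;
  gaddN : forall x, gadd x (gopp x) = gzero }.

Arguments gzero {A} : rename.
Arguments gadd {A} : rename.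
Arguments gopp {A} : rename.

Declare Scope grp_scope.
Delimit Scope grp_scope with G.
Notation "x + y" := (gadd x y) : grp_scope.
Notation "- x" := (gopp x) : grp_scope.
Notation "x - y" := (gadd x (gopp y)) : grp_scope.
Notation "0" := gzero : grp_scope.

Section Linear.
Context (A : abgroup).
Local Open Scope grp_scope.
Implicit Types (x y z u v : A) (env : list A).

Lemma gadd0l x : 0 + x = x.
Proof. now rewrite gaddC, gadd0. Qed.

Lemma gadd_cancel x y z : x + y = x + z -> y = z.
Proof.
  intros H.
  assert (E : - x + (x + y) = - x + (x + z)) by now rewrite H.
  now rewrite !gaddA, (gaddC _ (- x)), gaddN, !gadd0l in E.
Qed.

Lemma gadd_swap x y u v : (x + y) + (u + v) = (x + u) + (y + v).
Proof. now rewrite <- !gaddA, (gaddA _ y), (gaddC _ y u), <- !gaddA. Qed.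

Lemma gopp_unique x y : x + y = 0 -> y = - x.
Proof. intros H. apply (gadd_cancel x). now rewrite H, gaddN. Qed.

Lemma gopp0 : - (0 : A) = 0.
Proof. symmetry. apply gopp_unique, gadd0. Qed.

Lemma goppD x y : - (x + y) = - x + - y.
Proof.
  symmetry. apply gopp_unique.
  now rewrite gadd_swap, !gaddN, gadd0.
Qed.

Lemma gsub_eq x y : x - y = 0 -> x = y.
Proof.
  intros H. apply (gadd_cancel (- y)).
  now rewrite (gaddC _ _ x), (gaddC _ _ y), H, gaddN.
Qed.

(** * Integer multiples in an abelian group *)

Fixpoint nmul (n : nat) x : A :=
  match n with O => 0 | S n => x + nmul n x end.

Lemma nmulD n m x : nmul (n + m) x = nmul n x + nmul m x.
Proof.
  induction n as [|n IH]; simpl; [now rewrite gadd0l|].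
  now rewrite IH, gaddA.
Qed.

Definition zmul (k : Z) x : A :=
  match k with
  | Z0 => 0
  | Zpos p => nmul (Pos.to_nat p) x
  | Zneg p => - nmul (Pos.to_nat p) x
  end.

(** Every integer is a difference of naturals, so this reduces additivity of [zmul] to that of
    [nmul]. *)
Lemma zmul_sub_nat n m x :
  zmul (Z.of_nat n - Z.of_nat m) x = nmul n x - nmul m x.
Proof.
  destruct (le_lt_dec m n) as [H|H].
  - replace (Z.of_nat n - Z.of_nat m)%Z with (Z.of_nat (n - m)%nat) by lia.
    replace n with ((n - m) + m)%nat at 2 by lia.
    rewrite nmulD, <- gaddA, gaddN, gadd0.
    destruct (n - m)%nat as [|k]; [reflexivity|].
    simpl Z.of_nat. unfold zmul. now rewrite SuccNat2Pos.id_succ.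
  - replace (Z.of_nat n - Z.of_nat m)%Z with (- Z.of_nat (m - n)%nat)%Z by lia.
    replace m with ((m - n) + n)%nat at 2 by lia.
    rewrite nmulD, goppD, (gaddC _ (- _)), gaddA, gaddN, gadd0l.
    destruct (m - n)%nat as [|k]; [simpl; now rewrite gopp0|].
    simpl Z.of_nat. unfold Z.opp, zmul. now rewrite SuccNat2Pos.id_succ.
Qed.

Lemma zmulD k l x : zmul (k + l) x = zmul k x + zmul l x.
Proof.
  assert (E : forall k, exists n m, k = (Z.of_nat n - Z.of_nat m)%Z).
  { intros j. exists (Z.to_nat j), (Z.to_nat (- j)). lia. }
  destruct (E k) as (n & m & ->), (E l) as (n' & m' & ->).
  replace (Z.of_nat n - Z.of_nat m + (Z.of_nat n' - Z.of_nat m'))%Z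
    with (Z.of_nat (n + n') - Z.of_nat (m + m'))%Z by lia.
  rewrite !zmul_sub_nat, !nmulD, goppD. apply gadd_swap.
Qed.

Lemma zmulN k x : zmul (- k) x = - zmul k x.
Proof.
  apply gopp_unique. rewrite <- zmulD. now rewrite Z.add_opp_diag_r.
Qed.

(** * Integer linear forms and a sound search for entailment *)

Fixpoint lin_eval env (l : list Z) : A :=
  match l, env with
  | k :: l, v :: env => zmul k v + lin_eval env l
  | _, _ => 0
  end.

Fixpoint lin_add (l m : list Z) : list Z :=
  match l, m with
  | [], _ => m
  | _, [] => l
  | a :: l, b :: m => (a + b)%Z :: lin_add l m
  end.

Definition lin_opp : list Z -> list Z := map Z.opp.

Lemma lin_addE env l m :
  lin_eval env (lin_add l m) = lin_eval env l + lin_eval env m.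
Proof.
  revert l m; induction env as [|v env IH]; intros [|a l] [|b m]; simpl;
    rewrite ?gadd0, ?gadd0l; trivial.
  now rewrite zmulD, IH, gadd_swap.
Qed.

Lemma lin_oppE env l : lin_eval env (lin_opp l) = - lin_eval env l.
Proof.
  revert l; induction env as [|v env IH]; intros [|a l]; simpl;
    rewrite ?gopp0; trivial.
  change (zmul (Z.opp a) v + lin_eval env (lin_opp l) = - (zmul a v + lin_eval env l)).
  now rewrite zmulN, IH, goppD.
Qed.

Inductive gexp := EVar (i : nat) | EZero | EAdd (e f : gexp) | EOpp (e : gexp).

(** The default zero for an index out of range agrees with [lin_eval], which drops coefficients
    beyond the end of [env]. *)
Fixpoint gexp_eval env (e : gexp) : A :=
  match e with
  | EVar i => nth i env 0
  | EZero => 0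
  | EAdd e f => gexp_eval env e + gexp_eval env f
  | EOpp e => - gexp_eval env e
  end.

Fixpoint lin_of (e : gexp) : list Z :=
  match e with
  | EVar i => repeat 0%Z i ++ [1%Z]
  | EZero => []
  | EAdd e f => lin_add (lin_of e) (lin_of f)
  | EOpp e => lin_opp (lin_of e)
  end.

Lemma lin_ofE env e : gexp_eval env e = lin_eval env (lin_of e).
Proof.
  induction e as [i| |e IHe f IHf|e IHe]; cbn [gexp_eval lin_of].
  - revert i; induction env as [|v env IH]; intros [|i]; simpl; trivial.
    + now destruct env; rewrite ?gadd0.
    + now rewrite IH, gadd0l.
  - now destruct env.
  - now rewrite lin_addE, IHe, IHf.
  - now rewrite lin_oppE, IHe.
Qed.

Definition lin_scale (k : Z) : list Z -> list Z := map (Z.mul k).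

Lemma lin_scale0 env h k : lin_eval env h = 0 -> lin_eval env (lin_scale k h) = 0.
Proof.
  intros Hh.
  assert (D : forall k l, lin_scale (k + l) h = lin_add (lin_scale k h) (lin_scale l h)).
  { intros m l. clear Hh. induction h as [|a h IH]; trivial.
    simpl. fold (lin_scale (m + l) h). now rewrite IH, Z.mul_add_distr_r. }
  assert (E1 : lin_scale 1 h = h).
  { clear - h. induction h as [|a h IH]; [reflexivity|].
    cbn [lin_scale map]. fold (lin_scale 1 h). now rewrite IH, Z.mul_1_l. }
  assert (EN : lin_scale (-1) h = lin_opp h).
  { clear - h. induction h as [|a h IH]; [reflexivity|].
    cbn [lin_scale map lin_opp]. fold (lin_scale (-1) h) (lin_opp h).
    now rewrite IH, Z.opp_eq_mul_m1, Z.mul_comm. }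
  induction k as [|k IH|k IH] using Z.peano_ind.
  - clear. revert env; induction h as [|a h IH]; intros [|v env]; trivial.
    simpl. now rewrite IH, gadd0.
  - unfold Z.succ. now rewrite D, lin_addE, IH, E1, Hh, gadd0.
  - unfold Z.pred. now rewrite D, lin_addE, IH, EN, lin_oppE, Hh, gopp0, gadd0.
Qed.

(** Only the coefficients 1 and -1 serve as pivots, since a group with torsion has no division. *)
Fixpoint lin_unit (h : list Z) : option (nat * Z) :=
  match h with
  | [] => None
  | a :: h =>
      if (Z.abs a =? 1)%Z then Some (O, a)
      else option_map (fun p => (S (fst p), snd p)) (lin_unit h)
  end.

(** A unit is its own inverse, so when [p] is the pivot of [h] this clears the pivot coordinate of
    [v]. *)
Definition lin_reduce (h : list Z) (p : nat * Z) (v : list Z) : list Z :=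
  lin_add v (lin_scale (- (nth (fst p) v 0%Z * snd p)) h).

(* The conditionals are nested rather than disjoined so that [vm_compute]
   stops at the first success. *)
Fixpoint lin_brute (hs : list (list Z)) (g : list Z) : bool :=
  match hs with
  | [] => forallb (Z.eqb 0) g
  | h :: hs =>
      if lin_brute hs g then true
      else if lin_brute hs (lin_add g (lin_scale 1 h)) then true
      else if lin_brute hs (lin_add g (lin_scale (-1) h)) then true
      else if lin_brute hs (lin_add g (lin_scale 2 h)) then true
      else lin_brute hs (lin_add g (lin_scale (-2) h))
  end.

(* Searches for [g] as an integer combination of [hs] and [ds]: forms with a
   unit coefficient are eliminated, the others are postponed to [ds]. *)
Fixpoint lin_search (n : nat) (hs ds : list (list Z)) (g : list Z) : bool :=
  match n, hs with
  | S n, h :: hs =>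
      match lin_unit h with
      | Some p =>
          let f := lin_reduce h p in lin_search n (map f hs) (map f ds) (f g)
      | None => lin_search n hs (if forallb (Z.eqb 0) h then ds else h :: ds) g
      end
  | S n, [] =>
      if existsb (fun h => if lin_unit h then true else false) ds
      then lin_search n ds [] g
      else lin_brute (filter (fun h => negb (forallb (Z.eqb 0) h)) ds) g
  | O, _ => lin_brute ds g
  end.

Lemma lin_brute_sound env hs g :
  Forall (fun h => lin_eval env h = 0) hs -> lin_brute hs g = true ->
  lin_eval env g = 0.
Proof.
  intros Hhs; revert g; induction Hhs as [|h hs Hh _ IH]; intros g; simpl.
  - revert g; induction env as [|v env IH]; intros [|a g]; simpl; trivial.
    destruct a; try discriminate. simpl. intros H. now rewrite IH, gadd0.
  - assert (E : forall k, lin_brute hs (lin_add g (lin_scale k h)) = true ->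
                          lin_eval env g = 0).
    { intros k H%IH. now rewrite lin_addE, lin_scale0, gadd0 in H. }
    repeat match goal with
           | |- (if ?b then _ else _) = _ -> _ => destruct b eqn:?
           end; eauto.
Qed.

Lemma lin_search_sound env n hs ds g :
  Forall (fun h => lin_eval env h = 0) hs ->
  Forall (fun h => lin_eval env h = 0) ds ->
  lin_search n hs ds g = true -> lin_eval env g = 0.
Proof.
  revert hs ds g; induction n as [|n IH]; intros hs ds g Hhs Hds; simpl;
    [now apply lin_brute_sound|].
  destruct Hhs as [|h hs Hh Hhs].
  { destruct existsb; [now apply IH|]. apply lin_brute_sound.
    now apply incl_Forall with (2 := Hds), incl_filter. }
  destruct (lin_unit h) as [p|]; [|apply IH; trivial; destruct forallb; auto].
  (* Adding a multiple of a vanishing form keeps the value, so soundness is independent of the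
     choice of pivot. *)
  assert (R : forall v : list Z, lin_eval env (lin_reduce h p v) = lin_eval env v).
  { intros w. unfold lin_reduce. now rewrite lin_addE, lin_scale0, gadd0. }
  intros H. rewrite <- R. refine (IH _ _ _ _ _ H);
    apply Forall_map; eapply Forall_impl; eauto; simpl; intros w Hw;
    now rewrite R.
Qed.

Definition eq_form (p : gexp * gexp) : list Z :=
  lin_of (EAdd (fst p) (EOpp (snd p))).

Definition eq_holds env (p : gexp * gexp) : Prop :=
  gexp_eval env (fst p) = gexp_eval env (snd p).

(** The hypotheses form one nested conjunction, so that a tactic can assemble their proof as a
    single term; the fuel only bounds the search. *)
Lemma lin_entail env hs e f :
  fold_right (fun p P => eq_holds env p /\ P) True hs ->
  lin_search (3 * length hs) (map eq_form hs) [] (eq_form (e, f)) = true ->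
  gexp_eval env e = gexp_eval env f.
Proof.
  intros Hhs Hs. apply gsub_eq.
  change (gexp_eval env (EAdd e (EOpp f)) = 0). rewrite lin_ofE.
  apply lin_search_sound with (3 := Hs); [|constructor].
  clear Hs. induction hs as [|p hs IH]; simpl; constructor.
  - unfold eq_form. rewrite <- lin_ofE. simpl. rewrite (proj1 Hhs). apply gaddN.
  - apply IH, Hhs.
Qed.
End Linear.

(** * Reification of group equations *)

Ltac g_mem x l :=
  match l with
  | nil => constr:(false)
  | cons x _ => constr:(true)
  | cons _ ?l => g_mem x l
  end.

Ltac g_atoms e l :=
  match e with
  | gadd ?x ?y => let l := g_atoms x l in g_atoms y l
  | gopp ?x => g_atoms x l
  | gzero => l
  | _ => match g_mem e l with true => l | false => constr:(cons e l) end
  end.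

Ltac g_index x l :=
  match l with
  | cons x _ => constr:(O)
  | cons _ ?l => let n := g_index x l in constr:(S n)
  end.

Ltac g_reify e l :=
  match e with
  | gadd ?x ?y =>
      let a := g_reify x l in let b := g_reify y l in constr:(EAdd a b)
  | gopp ?x => let a := g_reify x l in constr:(EOpp a)
  | gzero => constr:(EZero)
  | _ => let n := g_index e l in constr:(EVar n)
  end.

Ltac g_collect A acc :=
  match goal with
  | H : @eq (carrier A) _ _ |- _ =>
      let acc :=
        lazymatch acc with
        | context [H] => fail
        | _ => constr:((acc, H))
        end in
      g_collect A acc
  | _ => constr:(acc)
  end.

Ltac g_hyp_atoms acc l :=
  lazymatch acc with
  | (?acc, ?H) =>
      lazymatch type of H with
      | ?x = ?y => let l := g_atoms x l in let l := g_atoms y l in g_hyp_atoms acc l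
      end
  | _ => l
  end.

Ltac g_hyp_forms acc l :=
  lazymatch acc with
  | (?acc, ?H) =>
      lazymatch type of H with
      | ?x = ?y =>
          let a := g_reify x l in let b := g_reify y l in
          let r := g_hyp_forms acc l in constr:(cons (a, b) r)
      end
  | _ => constr:(@nil (gexp * gexp))
  end.

Ltac g_hyp_proof acc :=
  lazymatch acc with
  | (?acc, ?H) => let r := g_hyp_proof acc in constr:(conj H r)
  | _ => constr:(I)
  end.

(* Proves an equation that is a small integer combination of the equations
   in the context. *)
Ltac grp :=
  lazymatch goal with
  | |- @eq (carrier ?A) ?x ?y =>
      let acc := g_collect A tt in
      let l := g_atoms x (@nil (carrier A)) in
      let l := g_atoms y l in
      let l := g_hyp_atoms acc l in
      let e := g_reify x l in
      let f := g_reify y l in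
      let hs := g_hyp_forms acc l in
      let pf := g_hyp_proof acc in
      refine (lin_entail A l hs e f pf _); vm_compute; reflexivity
  end.

(** Tries the disequalities of the context in turn, until the excluded equation follows from the
    equations there. *)
Ltac gcontra :=
  exfalso;
  match goal with
  | H : ?x <> ?y |- _ => apply H; clear H; grp
  end.


Ltac mem H := simpl in H; repeat destruct H as [H|H]; try (exfalso; exact H).

Ltac inl := simpl; tauto.

Ltac incls := intros ? ?K; simpl in *; tauto.

(** * Symmetries of two-colourings *)

Section Dihedral.
Context (A : abgroup).
Local Open Scope grp_scope.
Implicit Types (x y z u v r s t a b h : A) (c e : A -> bool) (g : A -> A)
  (l : list A).

(** Fibres of doubling are cosets of the 2-torsion, so this says that there is at most one element
    of order two. *)
Definition two_torsion_small : Prop := forall x y z,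
  x + x = y + y -> x + x = z + z -> x = y \/ x = z \/ y = z.

Definition periodic c r : Prop := forall u, c (u + r) = c u.

Definition mirror c b : Prop := forall u, c (b - u) = c u.

Definition dihedral g : Prop :=
  (exists s, s <> 0 /\ forall u, g u = u + s) \/ (exists b, forall u, g u = b - u).

Definition symmetric c g : Prop := forall u, c (g u) = c u.

Definition flip l c u : bool :=
  if excluded_middle_informative (In u l) then negb (c u) else c u.

Lemma flip_in l c u : In u l -> flip l c u = negb (c u).
Proof. unfold flip. now destruct excluded_middle_informative. Qed.

Lemma flip_out l c u : ~ In u l -> flip l c u = c u.
Proof. unfold flip. now destruct excluded_middle_informative. Qed.

Lemma flip_symmetric_same l c g u :
  symmetric (flip l c) g -> (In u l <-> In (g u) l) -> c (g u) = c u.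
Proof.
  intros H Hu. specialize (H u).
  destruct (classic (In u l)) as [I|I].
  - rewrite (flip_in _ _ u), flip_in in H by tauto.
    now destruct (c (g u)), (c u).
  - rewrite (flip_out _ _ u), flip_out in H by tauto. trivial.
Qed.

Lemma flip_symmetric_leave l c g u :
  symmetric (flip l c) g -> In u l -> ~ In (g u) l -> c (g u) = negb (c u).
Proof. intros H I O. rewrite <- (flip_in l), <- (flip_out l (c) (g u)); auto. Qed.

Lemma flip_symmetric_enter l c g u :
  symmetric (flip l c) g -> ~ In u l -> In (g u) l -> c u = negb (c (g u)).
Proof.
  intros H I O. rewrite <- (flip_in l _ (g u)), <- (flip_out l c u); auto.
Qed.

Lemma periodicD c r s : periodic c r -> periodic c s -> periodic c (r + s).
Proof. intros Hr Hs u. now rewrite gaddA, Hs, Hr. Qed.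

Lemma periodicN c r : periodic c r -> periodic c (- r).
Proof. intros Hr u. rewrite <- Hr. f_equal. grp. Qed.

Lemma mirrors_periodic c a b : mirror c a -> mirror c b -> periodic c (b - a).
Proof.
  intros Ha Hb u. rewrite <- (Ha u), <- (Hb (a - u)). f_equal. grp.
Qed.

(** Conjugation by [g] turns the translation by [r] into that by [r] or [- r], and both are
    periods. *)
Lemma dihedral_periodic c g r u :
  dihedral g -> periodic c r -> c (g (u + r)) = c (g u).
Proof.
  intros [(s & _ & E)|(b & E)] Hr; rewrite !E.
  - rewrite <- (Hr (u + s)). f_equal. grp.
  - rewrite <- (Hr (b - (u + r))). f_equal. grp.
Qed.

Lemma dihedral_involution g r u :
  dihedral g -> r + r = 0 -> g (u + r) = g u + r.
Proof. intros [(s & _ & E)|(b & E)] Hr; rewrite !E; grp. Qed.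

Lemma dihedral_inj g u v : dihedral g -> g u = g v -> u = v.
Proof. intros [(s & _ & E)|(b & E)]; rewrite !E; intros; grp. Qed.

(** A nonzero translation has no fixed point, so [g] must be the mirror through [u]. *)
Lemma dihedral_fix g u : dihedral g -> g u = u -> forall v, g v = u + u - v.
Proof.
  intros [(s & N & E)|(b & E)] F v; rewrite E in F |- *; [gcontra|grp].
Qed.

(* If [g] moves a point of a monochromatic [l] outside [l], then [c] and
   [c \o g] differ there, hence at all its translates by periods; such a
   translate outside [l] would be mapped into [l] and have the other colour. *)
Lemma period_stays c g l (alpha : bool) u r :
  dihedral g -> symmetric (flip l c) g -> (forall v, In v l -> c v = alpha) ->
  In u l -> ~ In (g u) l -> periodic c r -> In (u + r) l.
Proof.
  intros D S M I O P. apply NNPP; intros N.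
  pose proof (flip_symmetric_leave _ _ _ _ S I O) as H1.
  pose proof (dihedral_periodic _ _ _ u D P) as H2.
  pose proof (P u) as H3. pose proof (M _ I) as H4.
  destruct (classic (In (g (u + r)) l)) as [J|J].
  - pose proof (flip_symmetric_enter _ _ _ _ S N J) as H5.
    rewrite H3, H4, (M _ J) in H5. now destruct alpha.
  - assert (H5 : c (g (u + r)) = c (u + r)).
    { apply (flip_symmetric_same l); tauto. }
    rewrite H2, H1, H3 in H5. now destruct (c u).
Qed.

(** * Scalene triples and colourings stuck on them *)

Definition scalene x y z : Prop :=
  (x <> y /\ y <> z /\ z <> x) /\ (x + y <> z + z /\ y + z <> x + x /\ z + x <> y + y).

(** Failure of the extension property at the triple. It depends only on the colours off the triple,
    which is why [stuck_change] may recolour the triple freely. *)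
Definition stuck x y z c : Prop := forall c',
  (forall u, u <> x -> u <> y -> u <> z -> c' u = c u) ->
  exists g, dihedral g /\ symmetric c' g.

Lemma scalene_rot x y z : scalene x y z -> scalene y z x.
Proof. unfold scalene; tauto. Qed.

Lemma stuck_rot x y z c : stuck x y z c -> stuck y z x c.
Proof. intros H c' H'. apply H; auto. Qed.

Lemma stuck_flip x y z c l : stuck x y z c -> incl l [x; y; z] ->
  exists g, dihedral g /\ symmetric (flip l c) g.
Proof.
  intros H I. apply H. intros u Hx Hy Hz. apply flip_out.
  intros J%I. simpl in J. intuition congruence.
Qed.

Lemma stuck_change x y z c l : stuck x y z c -> incl l [x; y; z] ->
  stuck x y z (flip l c).
Proof.
  intros H I c' H'. apply H. intros u Hx Hy Hz. rewrite H' by trivial.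
  apply flip_out. intros J%I. simpl in J. intuition congruence.
Qed.

Hypothesis Htor : two_torsion_small.

(** A nonzero translation preserving three points would permute them cyclically and make one the
    midpoint of the others. A mirror would fix one and swap the others, again a midpoint, or fix all
    three, against [Htor]. *)
Lemma scalene_moved x y z g : scalene x y z -> dihedral g ->
  exists u, In u [x; y; z] /\ ~ In (g u) [x; y; z].
Proof.
  intros ((N1 & N2 & N3) & (S1 & S2 & S3)) D. apply NNPP; intros N.
  assert (Hg : forall u, In u [x; y; z] -> In (g u) [x; y; z]).
  { intros u Hu. apply NNPP; intros O. now apply N; exists u. }
  clear N.
  pose proof (Hg x ltac:(inl)) as Gx. pose proof (Hg y ltac:(inl)) as Gy.
  pose proof (Hg z ltac:(inl)) as Gz. clear Hg.
  destruct D as [(s & Ns & E)|(b & E)]; rewrite E in Gx, Gy, Gz;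
    mem Gx; mem Gy; mem Gz; try gcontra.
  destruct (Htor x y z) as [F|[F|F]]; try gcontra; grp.
Qed.

(** * Excluding periods of order greater than two *)

Lemma long_period_pair x y c g r : x <> y -> periodic c r -> r + r <> 0 ->
  dihedral g -> symmetric (flip [x; y] c) g -> c x <> c y -> x + x = y + y.
Proof.
  intros Nxy P Nr D S Nc.
  assert (K : forall x y, x <> y -> symmetric (flip [x; y] c) g -> c x <> c y -> g x = x).
  { clear x y Nxy S Nc. intros x y Nxy S Nc.
    assert (Gx : In (g x) [x; y]).
    { apply NNPP; intros O.
      pose proof (flip_symmetric_leave _ _ _ _ S ltac:(inl) O) as H1.
      (* The translate [x + t] is not recoloured, since [c x <> c y]. If [g x] leaves the pair, the
         colours force [x + t] to land on [y]; this happens for both [r] and [r + r], against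
         injectivity. *)
      assert (Q : forall t, periodic c t -> t <> 0 -> g (x + t) = y).
      { intros t Pt Nt.
        pose proof (dihedral_periodic _ _ _ x D Pt) as H2. pose proof (Pt x) as H3.
        assert (Ot : ~ In (x + t) [x; y]).
        { intros J; mem J; [gcontra|]. rewrite <- J in H3. congruence. }
        destruct (classic (In (g (x + t)) [x; y])) as [J|J].
        - pose proof (flip_symmetric_enter _ _ _ _ S Ot J) as H4.
          mem J; [|congruence].
          rewrite <- J in H4. rewrite H3 in H4. now destruct (c x).
        - assert (H5 : c (g (x + t)) = c (x + t)).
          { apply (flip_symmetric_same [x; y]); tauto. }
          rewrite H2, H1, H3 in H5. now destruct (c x). }
      assert (Nr0 : r <> 0) by (intros E; apply Nr; grp).
      pose proof (Q r P Nr0) as Q1.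
      pose proof (Q (r + r) (periodicD _ _ _ P P) Nr) as Q2.
      rewrite <- Q2 in Q1. apply (dihedral_inj _ _ _ D) in Q1. gcontra. }
    mem Gx; [now symmetry|].
    assert (c (g x) = c x) by (apply (flip_symmetric_same [x; y]); trivial; rewrite <- Gx; inl).
    congruence. }
  pose proof (K x y Nxy S Nc) as Gx.
  assert (S' : symmetric (flip [y; x] c) g).
  { intros u.
    assert (E : forall v, flip [y; x] c v = flip [x; y] c v).
    { intros v. unfold flip.
      destruct excluded_middle_informative, excluded_middle_informative; trivial;
        simpl in *; tauto. }
    rewrite !E. apply S. }
  pose proof (K y x (not_eq_sym Nxy) S' (not_eq_sym Nc)) as Gy.
  pose proof (dihedral_fix _ _ D Gx y) as E. rewrite Gy in E. grp.
Qed.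

(** Points of different colours have equal doubles by [long_period_pair]; three points cannot all
    have the same double, so the triple is monochromatic. Then [period_stays] puts [u + r] and
    [u - r] into the triple, with midpoint [u]. *)
Lemma no_long_period x y z c r : scalene x y z -> stuck x y z c ->
  periodic c r -> r + r = 0.
Proof.
  intros Sc St P. apply NNPP; intros Nr.
  assert (K : forall x y z, scalene x y z -> stuck x y z c -> x + x <> y + y -> c x = c y).
  { clear x y z Sc St. intros x y z Sc St N2.
    apply NNPP; intros Nc. apply N2.
    destruct (stuck_flip _ _ _ _ [x; y] St ltac:(incls)) as (g & D & S).
    apply (long_period_pair x y c g r); trivial. apply Sc. }
  assert (Kxy := K x y z Sc St).
  assert (Kyz := K y z x (scalene_rot _ _ _ Sc) (stuck_rot _ _ _ _ St)).
  assert (Kzx := K z x y (scalene_rot _ _ _ (scalene_rot _ _ _ Sc))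
                   (stuck_rot _ _ _ _ (stuck_rot _ _ _ _ St))).
  assert (Mono : c y = c x /\ c z = c x).
  { clear K P St. destruct Sc as ((N1 & N2 & N3) & _).
    assert (T : x + x = y + y -> y + y = z + z -> False).
    { intros E1 E2. destruct (Htor x y z) as [F|[F|F]]; auto; grp. }
    destruct (classic (x + x = y + y)) as [E1|E1].
    - assert (E : c y = c z) by auto.
      rewrite E. split; apply Kzx; intros E3; apply T; trivial; grp.
    - split; [symmetry; auto|].
      destruct (classic (y + y = z + z)) as [E2|E2].
      + apply Kzx. intros E3. apply E1. grp.
      + rewrite <- Kyz by trivial. symmetry; auto. }
  destruct Mono as [My Mz].
  destruct (stuck_flip _ _ _ _ [x; y; z] St ltac:(incls)) as (g & D & S).
  destruct (scalene_moved _ _ _ _ Sc D) as (u & I & O).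
  assert (M : forall v, In v [x; y; z] -> c v = c x).
  { intros v J. mem J; subst; trivial. }
  pose proof (period_stays _ _ _ _ _ _ D S M I O P) as I1.
  pose proof (period_stays _ _ _ _ _ _ D S M I O (periodicN _ _ P)) as I2.
  clear - Sc I I1 I2 Nr. destruct Sc as ((N1 & N2 & N3) & (S1 & S2 & S3)).
  assert (Nr0 : r <> 0) by (intros E; apply Nr; grp).
  mem I; mem I1; mem I2; gcontra.
Qed.

(** * Excluding periods of order two *)

Lemma flip_symmetric_stable l c g : symmetric (flip l c) g ->
  (forall u, In u l <-> In (g u) l) -> symmetric c g.
Proof. intros S H u. now apply (flip_symmetric_same l). Qed.

(** If [g] moved [w], [period_stays] would put [w + r] into [[w]]. So [g] is the mirror through [w],
    and it preserves [c] as well. *)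
Lemma short_period_single x y z c r w : stuck x y z c -> periodic c r -> r <> 0 ->
  In w [x; y; z] -> mirror c (w + w).
Proof.
  intros St P Nr Iw.
  destruct (stuck_flip _ _ _ _ [w] St) as (g & D & S).
  { intros v J. mem J. now subst. }
  assert (Gw : g w = w).
  { apply NNPP; intros N.
    assert (I : In (w + r) [w]).
    { apply (period_stays c g [w] (c w) w r); trivial; try inl.
      - intros v J. mem J. now subst.
      - intros J. mem J. auto. }
    mem I. gcontra. }
  pose proof (dihedral_fix _ _ D Gw) as E.
  intros u. rewrite <- E. apply (flip_symmetric_stable [w]); trivial.
  intros v. simpl. rewrite E. split; intros [F|[]]; left; grp.
Qed.

(** Exactly one of [u] and [u + r] is recoloured, so the new colours of [g u] and [g u + r] differ
    and one of these two points lies in [l]. *)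
Lemma short_period_image c g l r u : periodic c r -> r + r = 0 ->
  dihedral g -> symmetric (flip l c) g -> In u l -> ~ In (u + r) l ->
  exists w, In w l /\
    ((g u = w /\ c w = c u) \/ (g u = w + r /\ c w = negb (c u))).
Proof.
  intros P R D S I O.
  destruct (classic (In (g u) l)) as [J|J].
  { exists (g u). split; trivial. left. split; trivial.
    apply (flip_symmetric_same l); tauto. }
  exists (g u + r). split.
  - apply NNPP; intros K.
    pose proof (S u) as H1. pose proof (S (u + r)) as H2.
    rewrite dihedral_involution in H2 by trivial.
    rewrite flip_out, flip_in in H1 by trivial.
    rewrite !flip_out, !P in H2 by trivial.
    rewrite H1 in H2. now destruct (c u).
  - right. split; [grp|]. rewrite P. now apply (flip_symmetric_leave l).
Qed.

Lemma not_antipodal x y r : r + r = 0 -> r <> 0 -> x <> y -> y <> x + r ->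
  x + x <> y + y.
Proof.
  intros R Nr N Na E.
  destruct (Htor x y (x + r)) as [F|[F|F]]; trivial; try grp; gcontra.
Qed.

(** The antipodal alternative of [short_period_image] needs two colours, so [g] preserves the pair.
    As the doubles of [x] and [y] differ, only the mirror swapping them is possible. *)
Lemma short_period_pair x y z c r : scalene x y z -> stuck x y z c ->
  periodic c r -> r + r = 0 -> r <> 0 -> y <> x + r -> c x = c y ->
  mirror c (x + y).
Proof.
  intros Sc St P R Nr Na C.
  assert (N : x <> y) by apply Sc.
  pose proof (not_antipodal _ _ _ R Nr N Na) as N2.
  destruct (stuck_flip _ _ _ _ [x; y] St ltac:(incls)) as (g & D & S).
  assert (G : forall u, In u [x; y] -> In (g u) [x; y]).
  { intros u I.
    assert (Cu : forall v, In v [x; y] -> c v = c x).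
    { intros v J. mem J; now subst. }
    destruct (short_period_image c g [x; y] r u) as (w & J & [(E & _)|(_ & F)]); trivial.
    - intros J. mem I; mem J; gcontra.
    - now rewrite E.
    - rewrite (Cu w), (Cu u) in F by trivial. now destruct (c x). }
  pose proof (G x ltac:(inl)) as Gx. pose proof (G y ltac:(inl)) as Gy.
  assert (E : forall u, g u = x + y - u).
  { destruct D as [(s & Ns & E)|(b & E)]; rewrite E in Gx, Gy; intros u; rewrite ?E;
      mem Gx; mem Gy; first [gcontra | grp]. }
  intros u. rewrite <- E. apply (flip_symmetric_stable [x; y]); trivial.
  intros v. simpl. rewrite E.
  split; intros [F|[F|[]]]; [right; left|left|right; left|left]; grp.
Qed.

(** After flipping the whole triple, [g] permutes [x], [y] and [z + r]. If it fixes [z] it preserves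
    the triple; otherwise known symmetries of [c] would give [z + r] the colour of [x] and [y]. *)
Lemma short_period_two_colours x y z c r : scalene x y z -> stuck x y z c ->
  periodic c r -> r + r = 0 -> r <> 0 ->
  y <> x + r -> z <> y + r -> x <> z + r -> c x = c y -> c z <> c x -> False.
Proof.
  intros Sc St P R Nr N1 N2 N3 C Cz.
  pose proof (short_period_pair _ _ _ _ _ Sc St P R Nr N1 C) as Mxy.
  pose proof (short_period_single _ _ _ _ _ x St P Nr ltac:(inl)) as Mx.
  pose proof (short_period_single _ _ _ _ _ y St P Nr ltac:(inl)) as My.
  destruct (stuck_flip _ _ _ _ [x; y; z] St ltac:(incls)) as (g & D & S).
  assert (Gim : forall u, In u [x; y; z] -> exists w, In w [x; y; z] /\
    ((g u = w /\ c w = c u) \/ (g u = w + r /\ c w = negb (c u)))).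
  { intros u I. apply (short_period_image c g); trivial.
    destruct Sc as ((D1 & D2 & D3) & _).
    intros J. clear - I J R Nr N1 N2 N3 D1 D2 D3. mem I; mem J; gcontra. }
  assert (G : forall u, In u [x; y] -> g u = x \/ g u = y \/ g u = z + r).
  { intros u I. assert (Cu : c u = c x) by (mem I; now subst).
    destruct (Gim u) as (w & J & [(E & F)|(E & F)]); [mem I; subst; inl| |];
      rewrite Cu in F; mem J; subst w; auto; try congruence;
      rewrite <- ?C in F; now destruct (c x). }
  assert (Gz : g z = z \/ g z = x + r \/ g z = y + r).
  { destruct (Gim z) as (w & J & [(E & F)|(E & F)]); [inl| |];
      mem J; subst w; auto; try congruence; now destruct (c z). }
  pose proof (G x ltac:(inl)) as Gx. pose proof (G y ltac:(inl)) as Gy.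
  assert (Gzr : g (z + r) = g z + r) by now apply dihedral_involution.
  assert (Inj : forall u v, g u = g v -> u = v) by (intros; now apply (dihedral_inj g)).
  assert (Fixed : forall u, In u [x; y] -> g u = u -> forall v, c (g v) = c v).
  { intros u I E v. rewrite (dihedral_fix _ _ D E).
    mem I; subst u; [apply Mx|apply My]. }
  assert (Cr : c (z + r) = c z) by apply P.
  destruct Sc as ((D1 & D2 & D3) & Sc).
  destruct Gz as [Gz|Gz].
  - destruct (scalene_moved x y z g) as (u & I & O); [now split|trivial|].
    apply O. clear O.
    assert (K : forall v, g v = z + r -> v = z + r).
    { intros v E. apply Inj. rewrite Gzr. grp. }
    mem I; subst u; [destruct Gx as [E|[E|E]]|destruct Gy as [E|[E|E]]|];
      try (rewrite ?E, ?Gz; inl); apply K in E; exfalso; gcontra.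
  - assert (K : forall p q, In p [x; y] -> In q [x; y] -> p <> q ->
      p <> z + r -> q <> z + r -> mirror c (p + p) -> mirror c (p + q) ->
      c p = c x -> c q = c x -> g z = p + r -> False).
    { clear Gz Gx Gy. intros p q Ip Iq Npq Npz Nqz Mp Mpq Cp Cq Gz.
      assert (Gzr' : g (z + r) = p) by grp.
      assert (Gp : forall u, In u [x; y] -> g u = q \/ g u = z + r).
      { intros u Iu. assert (Nu : g u <> p).
        { rewrite <- Gzr'. intros E%Inj. clear - Iu Ip Iq Npz Nqz Npq E.
          mem Ip; mem Iq; mem Iu; gcontra. }
        pose proof (G u Iu) as Gu. clear - Iq Ip Npq Gu Nu.
        destruct Gu as [Gu|[Gu|Gu]]; auto; mem Ip; mem Iq; subst; auto; congruence. }
      destruct (Gp p Ip) as [Ep|Ep], (Gp q Iq) as [Eq|Eq].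
      - apply Npq, Inj. now rewrite Ep.
      (* Here [g] is a 3-cycle, so not a mirror. Its step [q - p] as a translation is a period of
         [c], being a composite of the mirrors [p + p] and [p + q]. *)
      - destruct D as [(s & Ns & E)|(b & E)]; rewrite E in *; [|gcontra].
        assert (H : c (z + r) = c q).
        { rewrite <- (mirrors_periodic _ _ _ Mp Mpq q). f_equal. grp. }
        congruence.
      (* The mirror through [q] preserves [c], but would send [p] to the differently coloured
         [z + r]. *)
      - pose proof (Fixed q Iq Eq p) as H. rewrite Ep in H. congruence.
      - apply Npq, Inj. now rewrite Ep. }
    destruct Gz as [Gz|Gz]; [apply (K x y)|apply (K y x)]; trivial; try inl;
      try (intros F; gcontra); try congruence.
    now rewrite gaddC.
Qed.

Lemma short_period_one_colour x y z c r : scalene x y z -> stuck x y z c ->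
  periodic c r -> r + r = 0 -> r <> 0 ->
  y <> x + r -> z <> y + r -> x <> z + r -> c x = c y -> c z = c x -> False.
Proof.
  intros Sc St P R Nr N1 N2 N3 C Cz.
  destruct (stuck_flip _ _ _ _ [x; y; z] St ltac:(incls)) as (g & D & S).
  destruct (scalene_moved _ _ _ _ Sc D) as (u & I & O).
  assert (Cu : forall v, In v [x; y; z] -> c v = c x).
  { intros v J. mem J; subst v; congruence. }
  destruct (short_period_image c g [x; y; z] r u) as (w & J & [(E & _)|(_ & F)]); trivial.
  - destruct Sc as ((D1 & D2 & D3) & _). clear - I N1 N2 N3 D1 D2 D3 R Nr.
    intros J. mem I; mem J; gcontra.
  - apply O. now rewrite E.
  - rewrite (Cu w), (Cu u) in F by trivial. now destruct (c x).
Qed.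

(** Flipping an antipodal pair keeps the period [r], so the flipped colouring violates it only at
    [z] and [z + r]. A symmetry permutes these two, and their colours differ, so it is the mirror
    through [z]. This mirror also preserves [c], hence it preserves the triple. *)
Lemma short_period_antipodal x y z c r : scalene x y z -> stuck x y z c ->
  periodic c r -> r + r = 0 -> r <> 0 -> y <> x + r.
Proof.
  intros Sc St P R Nr E.
  pose proof (short_period_single _ _ _ _ _ z St P Nr ltac:(inl)) as Mz.
  destruct (stuck_flip _ _ _ _ [x; y; z] St ltac:(incls)) as (g & D & S).
  destruct (scalene_moved _ _ _ _ Sc D) as (u & I & O).
  destruct Sc as ((D1 & D2 & D3) & _).
  assert (Oz : ~ In (z + r) [x; y; z]).
  { clear - D1 D2 D3 R Nr E. intros J. mem J; gcontra. }
  assert (Sz : forall v, flip [x; y; z] c (v + r) <> flip [x; y; z] c v ->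
                 v = z \/ v = z + r).
  { intros v Hv. destruct (classic (In v [x; y])) as [J|J].
    - exfalso; apply Hv. rewrite !flip_in, P; trivial; clear - J E R.
      + mem J; inl.
      + mem J; [right; left|left]; grp.
    - destruct (classic (v = z)) as [F|F]; auto.
      right. apply NNPP; intros F'. apply Hv.
      rewrite !flip_out, P; trivial.
      + intros K. apply J. mem K; [left; grp|right; left; grp|congruence].
      + intros K. clear Hv. mem K; [apply J; right; left; grp|apply J; left; grp|apply F'; grp]. }
  assert (Gz : g z = z).
  { destruct (Sz (g z)) as [F|F]; trivial.
    - rewrite <- dihedral_involution, !S by trivial.
      rewrite flip_out, flip_in, P by (trivial; inl). now destruct (c z).
    - pose proof (S z) as H. rewrite F, flip_out, flip_in, P in H by (trivial; inl).
      now destruct (c z). }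
  pose proof (flip_symmetric_leave _ _ _ _ S I O) as H.
  rewrite (dihedral_fix _ _ D Gz), Mz in H. now destruct (c u).
Qed.

Lemma stuck_aperiodic x y z c r : scalene x y z -> stuck x y z c ->
  periodic c r -> r = 0.
Proof.
  intros Sc St P. apply NNPP; intros Nr.
  assert (R : r + r = 0) by now apply (no_long_period x y z c).
  assert (Sc1 := scalene_rot _ _ _ Sc). assert (St1 := stuck_rot _ _ _ _ St).
  assert (Sc2 := scalene_rot _ _ _ Sc1). assert (St2 := stuck_rot _ _ _ _ St1).
  assert (N1 := short_period_antipodal _ _ _ _ _ Sc St P R Nr).
  assert (N2 := short_period_antipodal _ _ _ _ _ Sc1 St1 P R Nr).
  assert (N3 := short_period_antipodal _ _ _ _ _ Sc2 St2 P R Nr).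
  pose proof (short_period_one_colour _ _ _ _ _ Sc St P R Nr N1 N2 N3) as K.
  pose proof (short_period_two_colours _ _ _ _ _ Sc St P R Nr N1 N2 N3) as K0.
  pose proof (short_period_two_colours _ _ _ _ _ Sc1 St1 P R Nr N2 N3 N1) as K1.
  pose proof (short_period_two_colours _ _ _ _ _ Sc2 St2 P R Nr N3 N1 N2) as K2.
  (* Among three points two share a colour, so one of the four colour patterns applies. *)
  clear - K K0 K1 K2. destruct (c x), (c y), (c z); intuition congruence.
Qed.

(** * The unique mirror of a stuck colouring, and jumps between mirrors *)

Lemma stuck_mirror x y z c : scalene x y z -> stuck x y z c -> exists a, mirror c a.
Proof.
  intros Sc St. destruct (St c) as (g & [(s & Ns & E)|(b & E)] & S); trivial.
  - destruct Ns. apply (stuck_aperiodic x y z c); trivial.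
    intros u. now rewrite <- E.
  - exists b. intros u. now rewrite <- E.
Qed.

Lemma stuck_mirror_unique x y z c a b : scalene x y z -> stuck x y z c ->
  mirror c a -> mirror c b -> b = a.
Proof.
  intros Sc St Ha Hb.
  assert (b - a = 0); [|grp].
  apply (stuck_aperiodic x y z c); trivial. now apply mirrors_periodic.
Qed.

(** Along the steps from [u] to [u + t] the colour changes only on entering [w] and on leaving its
    mirror image [a - w]. *)
Definition jump c a w t : Prop :=
  t <> 0 /\ forall u, c (u + t) <> c u <-> u = w - t \/ u = a - w.

(* The composite of the mirrors of [c] and of [c] flipped at [w] is a
   translation by [t] under which [c] changes at exactly two places. *)
Lemma stuck_jump x y z c a w : scalene x y z -> stuck x y z c -> mirror c a ->
  In w [x; y; z] -> a - w <> w -> exists t, jump c a w t.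
Proof.
  intros Sc St Ma Iw Nw.
  assert (Inc : incl [w] [x; y; z]) by (intros v J; mem J; now subst).
  destruct (stuck_mirror x y z (flip [w] c)) as (b & Mb); trivial.
  { now apply stuck_change. }
  assert (S : symmetric (flip [w] c) (fun u => b - u)) by exact Mb.
  exists (b - a).
  assert (Nb : b - w <> w).
  { intros E.
    assert (Hb : mirror c b).
    { apply (flip_symmetric_stable [w] c _ S). intros u. simpl.
      split; intros [F|[]]; left; grp. }
    pose proof (stuck_mirror_unique _ _ _ _ _ _ Sc St Ma Hb). gcontra. }
  split.
  - intros E.
    assert (H : c (b - w) = negb (c w)).
    { apply (flip_symmetric_leave [w] c _ w S); [inl|]. intros J; mem J; auto. }
    replace (b - w) with (a - w) in H by grp. rewrite Ma in H. now destruct (c w).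
  - intros u. replace (u + (b - a)) with (b - (a - u)) by grp.
    rewrite <- (Ma u).
    destruct (classic (a - u = w)) as [E|E].
    + split; intros _; [right; grp|].
      rewrite (flip_symmetric_leave [w] c _ (a - u) S); [now destruct (c (a - u))| |].
      * now left.
      * intros J; mem J. gcontra.
    + destruct (classic (b - (a - u) = w)) as [F|F].
      * split; intros _; [left; grp|].
        rewrite (flip_symmetric_enter [w] c _ (a - u) S);
          [now destruct (c (b - (a - u)))| |now left].
        intros J; mem J; auto.
      * split.
        -- intros H; destruct H. apply (flip_symmetric_same [w] c _ (a - u) S).
           simpl. intuition congruence.
        -- intros [H|H]; gcontra.
Qed.

Lemma jump_stay c a w t u : jump c a w t -> u <> w - t -> u <> a - w ->
  c (u + t) = c u.
Proof. intros (_ & J) N1 N2. apply NNPP. rewrite J. tauto. Qed.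

Lemma jump_before c a w t : jump c a w t -> c (w - t) <> c w.
Proof.
  intros (_ & J) E. apply (J (w - t)); auto. rewrite E. f_equal. grp.
Qed.

Lemma jump_after c a w t : mirror c a -> jump c a w t -> c (a - w + t) <> c w.
Proof. intros Ma (_ & J) E. apply (J (a - w)); auto. now rewrite E, Ma. Qed.

(** Both parts walk round a parallelogram with sides [s] and [t]. If the equality failed, the colour
    would be constant along three sides, but it changes along the fourth, from [z - t] to [z]. *)
Lemma jump_pair c a y z s t : mirror c a -> jump c a y s -> jump c a z t ->
  y <> z -> c y = c z ->
  z - t = a - (y - s) /\ (y <> a - z -> z - t = y - s).
Proof.
  intros Ma Jy Jz N C.
  pose proof (jump_before _ _ _ _ Jy) as By. pose proof (jump_before _ _ _ _ Jz) as Bz.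
  pose proof (jump_after _ _ _ _ Ma Jy) as Ay. pose proof (jump_after _ _ _ _ Ma Jz) as Az.
  assert (Nt : t <> 0) by apply Jz. assert (Ns : s <> 0) by apply Jy.
  split.
  - apply NNPP; intros H.
    assert (H1 : c (z - s) = c z).
    { rewrite <- (jump_stay c a y s (z - s) Jy).
      - f_equal; grp.
      - intros E; gcontra.
      - intros E; apply Ay; rewrite C; f_equal; grp. }
    assert (H2 : c (z - t - s) = c (z - s)).
    { rewrite <- (jump_stay c a z t (z - t - s) Jz).
      - f_equal; grp.
      - intros E; apply Ns; grp.
      - intros E; apply Az; rewrite <- H1; f_equal; grp. }
    apply Bz. rewrite <- H1, <- H2, <- (jump_stay c a y s (z - t - s) Jy).
    + f_equal; grp.
    + intros E; apply Bz; rewrite <- C; f_equal; grp.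
    + intros E; apply H; grp.
  - intros Na. apply NNPP; intros H.
    assert (H1 : c (z + s) = c z).
    { apply (jump_stay c a y s z Jy).
      - intros E; apply By; rewrite C; f_equal; grp.
      - intros E; apply Na; grp. }
    assert (H2 : c (z - t + s) = c (z - t)).
    { apply (jump_stay c a y s (z - t) Jy); trivial.
      intros E; apply Bz; rewrite E, Ma; trivial. }
    apply Bz. rewrite <- H2, <- H1, <- (jump_stay c a z t (z - t + s) Jz).
    + f_equal; grp.
    + intros E; apply Ns; grp.
    + intros E; apply Az; rewrite <- H1; f_equal; grp.
Qed.

(** As [h] lies on the mirror, the two colour changes occur on the consecutive steps from [h - t] to
    [h] and from [h] to [h + t]; recolouring [h] removes both. *)
Lemma jump_periodic c a w t h : jump c a w t -> w - t = h -> h + h = a ->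
  periodic (flip [h] c) (w - h).
Proof.
  intros (Nt & J) E H u.
  assert (Nwh : w <> h) by (intros F; apply Nt; grp).
  replace (u + (w - h)) with (u + t) by grp.
  destruct (classic (u = h)) as [F|F]; [|destruct (classic (u + t = h)) as [F'|F']].
  - rewrite (flip_in [h] c u), flip_out; [| |now left].
    + assert (c (u + t) <> c u) by (apply J; left; grp).
      now destruct (c (u + t)), (c u).
    + intros K; mem K. gcontra.
  - rewrite (flip_in [h] c (u + t)), flip_out; [|intros K; mem K; auto|now left].
    assert (c (u + t) <> c u) by (apply J; right; grp).
    now destruct (c (u + t)), (c u).
  - rewrite !flip_out by (intros K; mem K; auto).
    apply NNPP. rewrite J. intros [K|K]; [apply F|apply F']; grp.
Qed.

(** The two flips at [h] cancel. The mirror is thus expressed over [flip [h] c], which will be the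
    periodic colouring. *)
Lemma stuck_flip_mirror x y z c h l : scalene x y z -> stuck x y z c ->
  incl l [x; y; z] -> ~ In h l ->
  exists b, symmetric (flip (h :: l) (flip [h] c)) (fun u => b - u).
Proof.
  intros Sc St I N.
  destruct (stuck_mirror x y z (flip l c)) as (b & Mb); trivial.
  { now apply stuck_change. }
  assert (E : forall u, flip (h :: l) (flip [h] c) u = flip l c u).
  { intros u. destruct (classic (h = u)) as [F|F].
    - rewrite !(flip_in) by now left. rewrite flip_out by now subst.
      now destruct (c u).
    - destruct (classic (In u l)) as [K|K].
      + rewrite flip_in, flip_out, flip_in; trivial.
        * intros J; mem J; auto.
        * now right.
      + rewrite !flip_out; trivial; simpl; tauto. }
  exists b. intros u. rewrite !E. apply Mb.
Qed.

(** * Periodic colourings flipped on a triple or a quadrilateral *)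

Lemma mirror_dihedral b : dihedral (fun u => b - u).
Proof. right. now exists b. Qed.

(** All differences within the triple are periods, so by [period_stays] the triple contains [h + r]
    for every period [r]. In particular it contains [y + z - h], which makes [h] the midpoint of [y]
    and [z]. *)
Lemma periodic_triple e h y z b : h <> y -> h <> z ->
  e y = e h -> e z = e h -> periodic e (y - h) -> periodic e (z - h) ->
  symmetric (flip [h; y; z] e) (fun u => b - u) -> ~ scalene h y z.
Proof.
  intros N1 N2 Cy Cz Py Pz S Sc.
  destruct (scalene_moved _ _ _ _ Sc (mirror_dihedral b)) as (u & I & O).
  assert (M : forall v, In v [h; y; z] -> e v = e h).
  { intros v J. mem J; now subst. }
  assert (K : forall r, periodic e r -> In (h + r) [h; y; z]).
  { intros r P.
    assert (Pu : periodic e (h - u)).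
    { clear - I Py Pz. mem I; subst u.
      - intros v. f_equal. grp.
      - replace (h - y) with (- (y - h)) by grp. now apply periodicN.
      - replace (h - z) with (- (z - h)) by grp. now apply periodicN. }
    replace (h + r) with (u + ((h - u) + r)) by grp.
    eapply period_stays; eauto using mirror_dihedral, periodicD. }
  pose proof (K _ (periodicN _ _ Py)) as K1.
  pose proof (K _ (periodicD _ _ _ Py Pz)) as K2.
  destruct Sc as (_ & (S1 & S2 & S3)). clear - N1 N2 K1 K2 S1 S2 S3.
  mem K1; mem K2; gcontra.
Qed.

Lemma not_scalene x y z : x <> y -> y <> z -> z <> x -> ~ scalene x y z ->
  x + y = z + z \/ y + z = x + x \/ z + x = y + y.
Proof. unfold scalene. intros. apply NNPP. tauto. Qed.

(* The mirror [b] can neither fix [h] (it would preserve the triple) nor swap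
   it with another vertex. *)
Lemma quadrilateral_moved x y z h b : scalene x y z ->
  h <> x -> h <> y -> h <> z -> ~ scalene h y z ->
  (x + x = h + h \/ (~ scalene h x y /\ ~ scalene h x z)) ->
  exists u, In u [h; x; y; z] /\ ~ In (b - u) [h; x; y; z].
Proof.
  intros Sc Nx Ny Nz Tyz T. apply NNPP; intros N.
  assert (Hb : forall u, In u [h; x; y; z] -> In (b - u) [h; x; y; z]).
  { intros u Hu. apply NNPP; intros O. now apply N; exists u. }
  clear N.
  assert (Nh : b - h <> h).
  { intros E. destruct (scalene_moved _ _ _ _ Sc (mirror_dihedral b)) as (u & I & O).
    destruct (Hb u) as [F|F]; [now right| |auto].
    assert (u = h) by grp. subst u. clear - I Nx Ny Nz. mem I; auto. }
  destruct Sc as ((N1 & N2 & N3) & (S1 & S2 & S3)).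
  pose proof (Hb h ltac:(inl)) as Gh. pose proof (Hb x ltac:(inl)) as Gx.
  pose proof (Hb y ltac:(inl)) as Gy. pose proof (Hb z ltac:(inl)) as Gz. clear Hb.
  apply not_scalene in Tyz; auto.
  assert (T' : x + x = h + h \/
    ((h + x = y + y \/ x + y = h + h \/ y + h = x + x) /\
     (h + x = z + z \/ x + z = h + h \/ z + h = x + x))).
  { destruct T as [T|(T1 & T2)]; auto. right. split; apply not_scalene; auto. }
  clear T.
  mem Gh; try gcontra; mem Gx; try gcontra; mem Gy; try gcontra; mem Gz; try gcontra;
    (destruct Tyz as [Q|[Q|Q]]; try gcontra;
     destruct T' as [T|([T|[T|T]] & [U|[U|U]])]; gcontra).
Qed.

Lemma periodic_quadrilateral_antipodal x y z e h b : scalene x y z ->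
  h <> x -> h <> y -> h <> z -> x + x = h + h ->
  e x = e h -> e y = e h -> e z = e h -> periodic e (y - h) -> periodic e (z - h) ->
  ~ scalene h y z -> ~ symmetric (flip [h; x; y; z] e) (fun u => b - u).
Proof.
  intros Sc Nx Ny Nz H Cx Cy Cz Py Pz T S.
  destruct (quadrilateral_moved x y z h b) as (u & I & O); auto.
  destruct Sc as ((N1 & N2 & N3) & (S1 & S2 & S3)).
  assert (M : forall v, In v [h; x; y; z] -> e v = e h).
  { intros v J. mem J; now subst. }
  assert (K : forall r, periodic e r -> In (u + r) [h; x; y; z]).
  { intros r P. eapply period_stays; eauto using mirror_dihedral. }
  assert (K' : forall r s, periodic e s -> u + s = h -> periodic e r -> In (h + r) [h; x; y; z]).
  { intros r s Ps Es Pr. replace (h + r) with (u + (s + r)) by grp. apply K. now apply periodicD. }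
  assert (Tor : forall v w, v <> w -> h <> v -> h <> w -> h + h = v + v -> h + h = w + w -> False).
  { intros v w F1 F2 F3 F4 F5. destruct (Htor h v w) as [F|[F|F]]; auto. }
  assert (Kh : u <> x -> In (h + - (y - h)) [h; x; y; z]).
  { intros Nu. pose proof (periodicN _ _ Py) as Ny'. pose proof (periodicN _ _ Pz) as Nz'.
    mem I; subst u.
    - now apply K.
    - congruence.
    - apply (K' _ (- (y - h))); trivial. grp.
    - apply (K' _ (- (z - h))); trivial. grp. }
  (* The difference [h - x] is not assumed to be a period, so for [u = x] the translates of [x]
     itself are examined; otherwise the image of [y] under the reflection in [h] lies in the
     quadrilateral. *)
  destruct (classic (u = x)) as [Eu|Eu].
  - subst u. clear Kh K' O I.
    pose proof (K _ (periodicN _ _ Py)) as K1. pose proof (K _ (periodicN _ _ Pz)) as K2.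
    pose proof (K _ Py) as K3. clear - K1 K2 K3 N1 N2 N3 S1 S2 S3 Nx Ny Nz H Tor.
    mem K3; try gcontra; mem K1; try gcontra; mem K2; try gcontra;
      apply (Tor x z); auto; grp.
  - specialize (Kh Eu). clear - Kh N1 N2 N3 S1 S2 S3 Nx Ny Nz H Tor.
    mem Kh; try gcontra. apply (Tor x y); auto; grp.
Qed.

Lemma periodic_quadrilateral x y z e h b : scalene x y z ->
  h <> x -> h <> y -> h <> z ->
  e x = e h -> e y = e h -> e z = e h ->
  periodic e (x - h) -> periodic e (y - h) -> periodic e (z - h) ->
  ~ scalene h y z -> ~ scalene h x y -> ~ scalene h x z ->
  ~ symmetric (flip [h; x; y; z] e) (fun u => b - u).
Proof.
  intros Sc Nx Ny Nz Cx Cy Cz Px Py Pz T1 T2 T3 S.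
  destruct (quadrilateral_moved x y z h b) as (u & I & O); auto.
  destruct Sc as ((N1 & N2 & N3) & (S1 & S2 & S3)).
  assert (M : forall v, In v [h; x; y; z] -> e v = e h).
  { intros v J. mem J; now subst. }
  assert (Pu : periodic e (h - u)).
  { clear - I Px Py Pz. mem I; subst u; [intros v; f_equal; grp|..].
    - replace (h - x) with (- (x - h)) by grp. now apply periodicN.
    - replace (h - y) with (- (y - h)) by grp. now apply periodicN.
    - replace (h - z) with (- (z - h)) by grp. now apply periodicN. }
  assert (K : forall r, periodic e r -> In (h - r) [h; x; y; z]).
  { intros r P. replace (h - r) with (u + ((h - u) - r)) by grp.
    eapply period_stays; eauto using mirror_dihedral, periodicD, periodicN. }
  assert (Tor : forall v w, v <> w -> h <> v -> h <> w -> h + h = v + v -> h + h = w + w -> False).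
  { intros v w F1 F2 F3 F4 F5. destruct (Htor h v w) as [F|[F|F]]; auto. }
  (* The reflection in [h] permutes [x], [y], [z]. If it fixes one and swaps the others, the fixed
     one is their midpoint; if it fixes all three, [Htor] fails. *)
  pose proof (K _ Px) as Kx. pose proof (K _ Py) as Ky. pose proof (K _ Pz) as Kz.
  clear - Kx Ky Kz N1 N2 N3 S1 S2 S3 Nx Ny Nz Tor.
  mem Kx; try gcontra; mem Ky; try gcontra; mem Kz; try gcontra;
    first [apply (Tor x y); auto; grp | apply (Tor y z); auto; grp
          | apply (Tor x z); auto; grp].
Qed.

(** * The mirror of a stuck colouring with a monochromatic triple *)

Lemma stuck_two_fixed_of_one x y z c a : scalene x y z -> stuck x y z c ->
  c y = c x -> c z = c x -> mirror c a -> a = x + x -> a = y + y \/ a = z + z.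
Proof.
  intros Sc St Cy Cz Ma Fx. apply NNPP; intros N.
  assert (Sc' := Sc). destruct Sc' as ((N1 & N2 & N3) & (S1 & S2 & S3)).
  destruct (stuck_jump x y z c a y) as (s & Jy); trivial; [inl|intros E; apply N; left; grp|].
  destruct (stuck_jump x y z c a z) as (t & Jz); trivial; [inl|intros E; apply N; right; grp|].
  (* The jumps at [y] and [z] start at a common point [h] on the mirror. It differs from [x] in
     colour but not in its double, so it is antipodal to [x]. *)
  destruct (jump_pair c a y z s t) as (E6 & E1); trivial; [congruence|].
  assert (Na : y <> a - z) by (intros E; gcontra).
  specialize (E1 Na). set (h := z - t) in *.
  assert (Hh : h + h = a) by grp.
  assert (Ch : c h <> c x).
  { rewrite <- Cz. apply (jump_before c a z t Jz). }
  assert (Py := jump_periodic c a y s h Jy (eq_sym E1) Hh).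
  assert (Pz := jump_periodic c a z t h Jz eq_refl Hh).
  clearbody h.
  assert (Nh : h <> x /\ h <> y /\ h <> z) by (repeat split; congruence).
  destruct Nh as (Nx & Ny & Nz).
  assert (Eh : flip [h] c h = negb (c h)) by (apply flip_in; now left).
  assert (Ew : forall w, h <> w -> c w = c x -> flip [h] c w = flip [h] c h).
  { intros w Nw Cw. rewrite Eh, flip_out, Cw; [now destruct (c h), (c x)|].
    intros J; mem J; auto. }
  destruct (stuck_flip_mirror x y z c h [y; z]) as (b & Sb); trivial;
    [incls|intros J; mem J; auto|].
  assert (T : ~ scalene h y z) by (apply (periodic_triple (flip [h] c) h y z b); auto).
  destruct (stuck_flip_mirror x y z c h [x; y; z]) as (b' & Sb'); trivial;
    [incls|intros J; mem J; auto|].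
  apply (periodic_quadrilateral_antipodal x y z (flip [h] c) h b'); auto. grp.
Qed.

Lemma stuck_some_fixed x y z c a : scalene x y z -> stuck x y z c ->
  c y = c x -> c z = c x -> mirror c a -> a = x + x \/ a = y + y \/ a = z + z.
Proof.
  intros Sc St Cy Cz Ma. apply NNPP; intros N.
  assert (Sc' := Sc). destruct Sc' as ((N1 & N2 & N3) & (S1 & S2 & S3)).
  destruct (stuck_jump x y z c a x) as (r & Jx); trivial; [inl|intros E; apply N; left; grp|].
  destruct (stuck_jump x y z c a y) as (s & Jy); trivial;
    [inl|intros E; apply N; right; left; grp|].
  destruct (stuck_jump x y z c a z) as (t & Jz); trivial;
    [inl|intros E; apply N; right; right; grp|].
  destruct (jump_pair c a x y r s) as (Exy & Exy'); auto.
  destruct (jump_pair c a y z s t) as (Eyz & Eyz'); auto; [congruence|].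
  destruct (jump_pair c a z x t r) as (Ezx & Ezx'); auto.
  (* At most one pair is swapped by the mirror; the other two pairs already identify all three
     starting points. *)
  assert (H : z - t = y - s /\ z - t = x - r).
  { destruct (classic (x = a - y)) as [F|F]; [|destruct (classic (y = a - z)) as [F'|F']].
    - assert (G1 : z - t = y - s) by (apply Eyz'; intros F'; gcontra).
      assert (G2 : x - r = z - t) by (apply Ezx'; intros F'; gcontra).
      auto.
    - assert (G1 : y - s = x - r) by auto.
      assert (G2 : x - r = z - t) by (apply Ezx'; intros F''; gcontra).
      split; grp.
    - assert (G1 : y - s = x - r) by auto. assert (G2 : z - t = y - s) by auto.
      split; grp. }
  destruct H as (Hy & Hx). clear Exy Exy' Eyz' Ezx Ezx'.
  set (h := z - t) in *.
  assert (Hh : h + h = a) by grp.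
  assert (Ch : c h <> c x).
  { rewrite <- Cz. apply (jump_before c a z t Jz). }
  assert (Px := jump_periodic c a x r h Jx (eq_sym Hx) Hh).
  assert (Py := jump_periodic c a y s h Jy (eq_sym Hy) Hh).
  assert (Pz := jump_periodic c a z t h Jz eq_refl Hh).
  clearbody h.
  assert (Nh : h <> x /\ h <> y /\ h <> z) by (repeat split; congruence).
  destruct Nh as (Nx & Ny & Nz).
  assert (Eh : flip [h] c h = negb (c h)) by (apply flip_in; now left).
  assert (Ew : forall w, h <> w -> c w = c x -> flip [h] c w = flip [h] c h).
  { intros w Nw Cw. rewrite Eh, flip_out, Cw; [now destruct (c h), (c x)|].
    intros J; mem J; auto. }
  assert (T : forall v w, h <> v -> h <> w -> incl [v; w] [x; y; z] ->
    c v = c x -> c w = c x -> periodic (flip [h] c) (v - h) ->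
    periodic (flip [h] c) (w - h) -> ~ scalene h v w).
  { intros v w Nv Nw I Cv Cw Pv Pw.
    destruct (stuck_flip_mirror x y z c h [v; w]) as (b & Sb); trivial;
      [intros J; mem J; auto|].
    apply (periodic_triple (flip [h] c) h v w b); auto. }
  destruct (stuck_flip_mirror x y z c h [x; y; z]) as (b & Sb); trivial;
    [incls|intros J; mem J; auto|].
  apply (periodic_quadrilateral x y z (flip [h] c) h b); auto;
    apply T; auto; incls.
Qed.

Lemma stuck_two_fixed x y z c a : scalene x y z -> stuck x y z c ->
  c y = c x -> c z = c x -> mirror c a ->
  (a = x + x /\ a = y + y) \/ (a = y + y /\ a = z + z) \/ (a = z + z /\ a = x + x).
Proof.
  intros Sc St Cy Cz Ma.
  assert (Sc1 := scalene_rot _ _ _ Sc). assert (St1 := stuck_rot _ _ _ _ St).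
  assert (Sc2 := scalene_rot _ _ _ Sc1). assert (St2 := stuck_rot _ _ _ _ St1).
  destruct (stuck_some_fixed x y z c a) as [F|[F|F]]; trivial.
  - assert (a = y + y \/ a = z + z) by now apply (stuck_two_fixed_of_one x y z c a).
    tauto.
  - assert (a = z + z \/ a = x + x).
    { apply (stuck_two_fixed_of_one y z x c a); trivial; now rewrite Cy, ?Cz. }
    tauto.
  - assert (a = x + x \/ a = y + y).
    { apply (stuck_two_fixed_of_one z x y c a); trivial; now rewrite Cz, ?Cy. }
    tauto.
Qed.

(* Both monochromatic colourings of the triple have their mirror through the
   unique antipodal pair of the triple, but a common mirror preserves the triple. *)
Lemma scalene_not_stuck x y z c : scalene x y z -> ~ stuck x y z c.
Proof.
  intros Sc St0.
  assert (K : exists c, stuck x y z c /\ forall v, In v [x; y; z] -> c v = true).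
  { exists (fun u => if excluded_middle_informative (In u [x; y; z]) then true else c u).
    split.
    - intros c' H. apply St0. intros u Hx Hy Hz. rewrite H by trivial.
      destruct excluded_middle_informative as [J|J]; trivial.
      exfalso. mem J; auto.
    - intros v J. now destruct excluded_middle_informative. }
  clear c St0. destruct K as (c & St & C).
  assert (St' : stuck x y z (flip [x; y; z] c)) by (apply stuck_change; trivial; incls).
  assert (C' : forall v, In v [x; y; z] -> flip [x; y; z] c v = false).
  { intros v J. now rewrite flip_in, C. }
  destruct (stuck_mirror _ _ _ _ Sc St) as (a & Ma).
  destruct (stuck_mirror _ _ _ _ Sc St') as (b & Mb).
  assert (Fa := stuck_two_fixed x y z c a Sc St).
  assert (Fb := stuck_two_fixed x y z _ b Sc St').
  rewrite !C in Fa by inl. rewrite !C' in Fb by inl.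
  specialize (Fa eq_refl eq_refl Ma). specialize (Fb eq_refl eq_refl Mb).
  assert (E : b = a).
  { destruct Sc as ((N1 & N2 & N3) & _). clear - Fa Fb N1 N2 N3 Htor.
    destruct Fa as [(A1 & A2)|[(A1 & A2)|(A1 & A2)]],
      Fb as [(B1 & B2)|[(B1 & B2)|(B1 & B2)]]; grp. }
  subst b.
  destruct (scalene_moved _ _ _ _ Sc (mirror_dihedral a)) as (u & I & O).
  pose proof (flip_symmetric_leave [x; y; z] c (fun u => a - u) u Mb I O) as H.
  simpl in H. rewrite Ma in H. now destruct (c u).
Qed.

(** * Extension from a scalene triple *)

Definition asymmetric c : Prop :=
  (forall r, periodic c r -> r = 0) /\ (forall b, ~ mirror c b).

Theorem scalene_extends x y z c0 : scalene x y z ->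
  exists c, (forall u, u <> x -> u <> y -> u <> z -> c u = c0 u) /\ asymmetric c.
Proof.
  intros Sc. apply NNPP; intros N. apply (scalene_not_stuck _ _ _ c0 Sc).
  intros c H. apply NNPP; intros G. apply N. exists c. split; trivial.
  split.
  - intros r P. apply NNPP; intros Nr. apply G. exists (fun u => u + r).
    split; [left; now exists r|trivial].
  - intros b M. apply G. exists (fun u => b - u).
    split; [apply mirror_dihedral|trivial].
Qed.
End Dihedral.

(** * The extension number of a dihedral action *)

Section Bounds.
Context (A : abgroup).
Local Open Scope grp_scope.
Implicit Types (x y z u v r s t a b h : A) (c : A -> bool) (l : list A).

(** * Sets without scalene triples *)

Definition no_scalene l : Prop := forall x y z,
  In x l -> In y l -> In z l -> ~ scalene A x y z.

Definition four_torsion t : Prop := t + t <> 0 /\ t + t + (t + t) = 0.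

Definition five_torsion t : Prop := t <> 0 /\ t + t + (t + t) + t = 0.

(** Some labelling makes the triple [b - t], [b], [b + t]. Comparing [s] with each of the two
    adjacent pairs leaves only the fourth corner of a square or the two missing corners of a regular
    pentagon. *)
Lemma isosceles_fourth l p q w : no_scalene l -> In p l -> In q l -> In w l ->
  p <> q -> q <> w -> w <> p ->
  exists b t, t <> 0 /\ forall s, In s l -> s <> p -> s <> q -> s <> w ->
    (four_torsion t /\ s = b + (t + t)) \/
    (five_torsion t /\ (s = b + (t + t) \/ s = b - (t + t))).
Proof.
  intros H.
  assert (K : forall x y z, In x l -> In y l -> In z l -> x <> y -> y <> z -> z <> x ->
    x + z = y + y -> exists b t, t <> 0 /\ forall s, In s l -> s <> x -> s <> y -> s <> z ->
    (four_torsion t /\ s = b + (t + t)) \/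
    (five_torsion t /\ (s = b + (t + t) \/ s = b - (t + t)))).
  { intros x y z Ix Iy Iz N1 N2 N3 E. exists y, (z - y).
    split; [intros F; gcontra|]. intros s Is M1 M2 M3.
    assert (T1 := not_scalene A y z s N2 (not_eq_sym M3) M2 (H y z s Iy Iz Is)).
    assert (T2 := not_scalene A x y s N1 (not_eq_sym M2) M1 (H x y s Ix Iy Is)).
    unfold four_torsion, five_torsion.
    assert (F1 : z - y <> 0) by (intros F; gcontra).
    assert (F2 : z - y + (z - y) <> 0) by (intros F; gcontra).
    destruct T1 as [T1|[T1|T1]], T2 as [T2|[T2|T2]]; try gcontra.
    - right. repeat split; trivial; [grp|]. right; grp.
    - right. repeat split; trivial; [grp|]. left; grp.
    - left. repeat split; trivial; grp. }
  intros Ip Iq Iw N1 N2 N3.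
  destruct (not_scalene A p q w N1 N2 N3 (H p q w Ip Iq Iw)) as [E|[E|E]].
  - destruct (K p w q) as (b & t & Nt & L); auto. exists b, t. auto.
  - destruct (K q p w) as (b & t & Nt & L); auto. exists b, t. auto.
  - destruct (K p q w) as (b & t & Nt & L); auto; [grp|]. exists b, t. auto.
Qed.

Lemma no_scalene_four l : NoDup l -> length l = 4 -> no_scalene l ->
  exists t, four_torsion t \/ five_torsion t.
Proof.
  destruct l as [|p [|q [|w [|v [|]]]]]; try discriminate. intros ND _ H.
  rewrite !NoDup_cons_iff in ND. simpl in ND.
  destruct (isosceles_fourth _ p q w H) as (b & t & _ & K); try (simpl; intuition congruence).
  exists t. destruct (K v) as [[T _]|[T _]]; simpl; intuition congruence.
Qed.

(** A square has only one corner left, so two further points force the pentagon. *)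
Lemma no_scalene_five l : NoDup l -> length l = 5 -> no_scalene l ->
  exists t, five_torsion t.
Proof.
  destruct l as [|p [|q [|w [|v [|v' [|]]]]]]; try discriminate. intros ND _ H.
  rewrite !NoDup_cons_iff in ND. simpl in ND.
  destruct (isosceles_fourth _ p q w H) as (b & t & _ & K); try (simpl; intuition congruence).
  exists t.
  destruct (K v) as [[T E]|[T _]]; try (simpl; intuition congruence).
  destruct (K v') as [[T' E']|[T' _]]; simpl; intuition congruence.
Qed.

(** Three further points do not fit: a square leaves one corner, a pentagon two, and [t] cannot have
    both orders. *)
Lemma no_scalene_six l : NoDup l -> length l = 6 -> ~ no_scalene l.
Proof.
  destruct l as [|p [|q [|w [|v [|v' [|v'' [|]]]]]]]; try discriminate. intros ND _ H.
  rewrite !NoDup_cons_iff in ND. simpl in ND.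
  destruct (isosceles_fourth _ p q w H) as (b & t & Nt & K); try (simpl; intuition congruence).
  assert (X : ~ (four_torsion t /\ five_torsion t)).
  { intros [(F1 & F2) (F3 & F4)]. apply F3. grp. }
  assert (K1 := K v). assert (K2 := K v'). assert (K3 := K v''). clear K H Nt.
  assert (D : v <> v' /\ v' <> v'' /\ v <> v'') by intuition congruence.
  destruct K1 as [[T1 E1]|[T1 [E1|E1]]]; try (simpl; intuition congruence);
  destruct K2 as [[T2 E2]|[T2 [E2|E2]]]; try (simpl; intuition congruence);
  destruct K3 as [[T3 E3]|[T3 [E3|E3]]]; try (simpl; intuition congruence).
Qed.

(** * Upper and lower bounds for a dihedral action *)

Context (Gamma : (A -> A) -> Prop).
Hypothesis Gamma_dihedral : forall g, Gamma g <->
  (exists s, forall u, g u = u + s) \/ (exists b, forall u, g u = b - u).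

Lemma ext_good_of_scalene m : two_torsion_small A ->
  (forall l, NoDup l -> length l = m -> ~ no_scalene l) -> ext_good A Gamma m.
Proof.
  intros Htor H W (l & Ll & ND & LW) _ c0.
  assert (K : exists x y z, In x l /\ In y l /\ In z l /\ scalene A x y z).
  { apply NNPP; intros N. apply (H l ND Ll). intros x y z Ix Iy Iz S.
    apply N. now exists x, y, z. }
  destruct K as (x & y & z & Ix & Iy & Iz & S).
  rewrite Forall_forall in LW.
  destruct (scalene_extends A Htor x y z c0 S) as (c & E & P & M).
  exists c. split.
  - intros u Nu. apply E; intros ->; apply Nu; auto.
  - intros g G Sg. apply Gamma_dihedral in G. destruct G as [(s & G)|(b & G)].
    + assert (s = 0) by (apply P; intros u; now rewrite <- G).
      intros u. rewrite G. grp.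
    + destruct (M b). intros u. now rewrite <- G.
Qed.

Lemma ext_good_le k m : k <= m -> ext_good A Gamma k -> ext_good A Gamma m.
Proof.
  intros L H W (l & Ll & ND & LW). apply H.
  exists (firstn k l). split; [rewrite length_firstn; lia|]. split.
  - rewrite <- (firstn_skipn k l) in ND. now apply NoDup_app_remove_r in ND.
  - rewrite <- (firstn_skipn k l) in LW. now apply Forall_app in LW.
Qed.

(** A translation fixing a point is the identity, and a mirror fixing both [u] and [v] would equate
    their doubles; so the stabilizer of [l] is trivial and no mirror is the identity. The constant
    precolouring is then a counterexample. *)
Lemma not_ext_good l : NoDup l ->
  (exists u v, In u l /\ In v l /\ u + u <> v + v) ->
  (forall c, (forall u, ~ In u l -> c u = true) -> exists b, mirror A c b) ->
  forall k, k <= length l -> ~ ext_good A Gamma k.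
Proof.
  intros ND (u & v & Iu & Iv & N) H k Hk G.
  apply (ext_good_le _ _ Hk) in G.
  destruct (G (fun w => In w l)) with (c0 := fun _ : A => true) as (c & E & D).
  - exists l. repeat split; trivial. now apply Forall_forall.
  - intros g Hg F. apply Gamma_dihedral in Hg. destruct Hg as [(s & Hg)|(b & Hg)].
    + intros w. pose proof (F u Iu) as Fu. rewrite Hg in Fu |- *. grp.
    + pose proof (F u Iu) as Fu. pose proof (F v Iv) as Fv. rewrite Hg in Fu, Fv. gcontra.
  - destruct (H c E) as (b & M).
    assert (F : forall w, b - w = w).
    { apply (D (fun w => b - w)); trivial. apply Gamma_dihedral. right. now exists b. }
    pose proof (F u) as Fu. pose proof (F v) as Fv. gcontra.
Qed.

Lemma mirror_of_support l c b : (forall u, ~ In u l -> c u = true) ->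
  (forall u, In u l -> In (b - u) l /\ c (b - u) = c u) -> mirror A c b.
Proof.
  intros E H u. destruct (classic (In u l)) as [I|I]; [now apply H|].
  rewrite !E; trivial. intros J. apply I. apply H in J. destruct J as [J _].
  replace (b - (b - u)) with u in J by grp. trivial.
Qed.

Ltac same_colour ps :=
  match ps with
  | ?p :: ?ps =>
      first [ match goal with |- In ?w _ /\ _ => replace w with p by grp end;
              split; [inl|congruence]
            | same_colour ps ]
  end.

(** The list [l] may omit points of the support [L], provided that these have the background colour
    [true]. *)
Ltac mirror_at l b :=
  exists b; apply (mirror_of_support l);
  [ intros ?u ?Hu;
    match goal with E : forall w, ~ In w ?L -> ?c w = true |- ?c ?u = true =>
      destruct (classic (In u L)) as [I|I];
      [mem I; subst u; solve [congruence | exfalso; apply Hu; inl] | now apply E]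
    end
  | intros ?u ?Hu; mem Hu; subst u; same_colour l ].

Lemma not_ext_good_three t k : t + t <> 0 -> k < 4 -> ~ ext_good A Gamma k.
Proof.
  intros Nt Hk. apply (not_ext_good [- t; 0; t]); [| | |simpl; lia].
  - repeat constructor; intros J; mem J; gcontra.
  - exists 0, t. repeat split; try inl. intros F; gcontra.
  - intros c E.
    destruct (c (- t)) eqn:C1, (c 0) eqn:C2, (c t) eqn:C3;
      (* If the end points differ in colour, the points coloured [false] are one end point, alone or
         with the middle, and they have a mirror of their own. *)
      first [ mirror_at [- t; 0; t] (0 : A) | mirror_at [0; t] t | mirror_at [t] (t + t)
            | mirror_at [- t; 0] (- t) | mirror_at [- t] (- t - t) ].
Qed.

(** Every two-colouring of the square formed by the multiples of [t] has one of its four mirrors. *)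
Lemma not_ext_good_four t k : four_torsion t -> k < 5 -> ~ ext_good A Gamma k.
Proof.
  intros (Nt & T) Hk. apply (not_ext_good [0; t; t + t; t + t + t]); [| | |simpl; lia].
  - repeat constructor; intros J; mem J; gcontra.
  - exists 0, t. repeat split; try inl. intros F; gcontra.
  - intros c E.
    destruct (c 0) eqn:C0, (c t) eqn:C1, (c (t + t)) eqn:C2, (c (t + t + t)) eqn:C3;
      first [ mirror_at [0; t; t + t; t + t + t] (0 : A)
            | mirror_at [0; t; t + t; t + t + t] t
            | mirror_at [0; t; t + t; t + t + t] (t + t)
            | mirror_at [0; t; t + t; t + t + t] (t + t + t) ].
Qed.

(** Every two-colouring of the regular pentagon formed by the multiples of [t] has one of its five
    mirrors. *)
Lemma not_ext_good_five t k : five_torsion t -> k < 6 -> ~ ext_good A Gamma k.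
Proof.
  intros (Nt & T) Hk.
  apply (not_ext_good [0; t; t + t; t + t + t; t + t + (t + t)]); [| | |simpl; lia].
  - repeat constructor; intros J; mem J; gcontra.
  - exists 0, t. repeat split; try inl. intros F; gcontra.
  - intros c E.
    destruct (c 0) eqn:C0, (c t) eqn:C1, (c (t + t)) eqn:C2, (c (t + t + t)) eqn:C3,
      (c (t + t + (t + t))) eqn:C4;
      first [ mirror_at [0; t; t + t; t + t + t; t + t + (t + t)] (0 : A)
            | mirror_at [0; t; t + t; t + t + t; t + t + (t + t)] t
            | mirror_at [0; t; t + t; t + t + t; t + t + (t + t)] (t + t)
            | mirror_at [0; t; t + t; t + t + t; t + t + (t + t)] (t + t + t)
            | mirror_at [0; t; t + t; t + t + t; t + t + (t + t)] (t + t + (t + t)) ].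
Qed.

(** * The extension number in terms of elements of order four and five *)

Hypothesis Htor : two_torsion_small A.

Theorem ext_D_four t : t + t <> 0 -> (forall s, ~ four_torsion s) ->
  (forall s, ~ five_torsion s) -> ext_D_eq A Gamma 4.
Proof.
  intros Nt N4 N5. split.
  - apply ext_good_of_scalene; trivial. intros l ND L NS.
    destruct (no_scalene_four l ND L NS) as (s & [T|T]); [now apply (N4 s)|now apply (N5 s)].
  - intros k. now apply (not_ext_good_three t).
Qed.

Theorem ext_D_five t : four_torsion t -> (forall s, ~ five_torsion s) ->
  ext_D_eq A Gamma 5.
Proof.
  intros T N5. split.
  - apply ext_good_of_scalene; trivial. intros l ND L NS.
    destruct (no_scalene_five l ND L NS) as (s & Ts). now apply (N5 s).
  - intros k. now apply (not_ext_good_four t).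
Qed.

Theorem ext_D_six t : five_torsion t -> ext_D_eq A Gamma 6.
Proof.
  intros T. split.
  - apply ext_good_of_scalene; trivial. intros l ND L. now apply no_scalene_six.
  - intros k. now apply (not_ext_good_five t).
Qed.
End Bounds.

(** * The cycle graph *)

Section Cycle.
Context (n : nat) (Hn : 0 < n).

Lemma cyc_vert_eq (i j : cyc_vert n) : proj1_sig i = proj1_sig j -> i = j.
Proof.
  destruct i as [i Hi], j as [j Hj]; simpl. intros ->. f_equal. apply proof_irrelevance.
Qed.

Definition cyc_of (k : nat) : cyc_vert n :=
  exist _ (k mod n) (Nat.mod_upper_bound k n (Nat.neq_sym _ _ (Nat.lt_neq _ _ Hn))).

Definition cyc_add (i j : cyc_vert n) : cyc_vert n :=
  cyc_of (proj1_sig i + proj1_sig j).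

Definition cyc_opp (i : cyc_vert n) : cyc_vert n := cyc_of (n - proj1_sig i).

Lemma cyc_of_val i : cyc_of (proj1_sig i) = i.
Proof. apply cyc_vert_eq. simpl. apply Nat.mod_small, (proj2_sig i). Qed.

Lemma cyc_of_add j k : cyc_add (cyc_of j) (cyc_of k) = cyc_of (j + k).
Proof. apply cyc_vert_eq. simpl. symmetry. apply Nat.Div0.add_mod. Qed.

Lemma cyc_addC i j : cyc_add i j = cyc_add j i.
Proof. unfold cyc_add. now rewrite Nat.add_comm. Qed.

Lemma cyc_addA i j k : cyc_add i (cyc_add j k) = cyc_add (cyc_add i j) k.
Proof.
  rewrite <- (cyc_of_val i), <- (cyc_of_val j), <- (cyc_of_val k), !cyc_of_add.
  now rewrite Nat.add_assoc.
Qed.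

Lemma cyc_add0 i : cyc_add i (cyc_of 0) = i.
Proof. rewrite <- (cyc_of_val i), cyc_of_add. now rewrite Nat.add_0_r. Qed.

Lemma cyc_addN i : cyc_add i (cyc_opp i) = cyc_of 0.
Proof.
  unfold cyc_opp. rewrite <- (cyc_of_val i) at 1. rewrite cyc_of_add.
  pose proof (proj2_sig i) as H; simpl in H.
  apply cyc_vert_eq; simpl. replace (_ + _) with n by lia.
  now rewrite Nat.Div0.mod_same, Nat.Div0.mod_0_l.
Qed.

Definition cyc_group : abgroup :=
  AbGroup (cyc_vert n) (cyc_of 0) cyc_add cyc_opp cyc_addA cyc_addC cyc_add0 cyc_addN.

Definition cyc_nat (k : nat) : cyc_group := cyc_of k.

Lemma cyc_nat_add j k : (cyc_nat j + cyc_nat k)%G = cyc_nat (j + k).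
Proof. apply cyc_of_add. Qed.

Lemma cyc_nat_val (i : cyc_group) : cyc_nat (proj1_sig i) = i.
Proof. apply cyc_of_val. Qed.

Lemma cyc_nat_eq0 k : cyc_nat k = 0%G <-> Nat.divide n k.
Proof.
  rewrite <- Nat.Lcm0.mod_divide. split; intros H.
  - apply (f_equal (@proj1_sig _ _)) in H. simpl in H.
    now rewrite Nat.Div0.mod_0_l in H.
  - apply cyc_vert_eq. simpl. now rewrite Nat.Div0.mod_0_l.
Qed.

(** Doubling a residue subtracts [n] at most once. Of three elements with equal doubles, two are
    treated alike and hence coincide. *)
Lemma cyc_two_torsion : two_torsion_small cyc_group.
Proof.
  assert (K : forall m, m < n + n -> m mod n = m /\ m < n \/ m mod n = m - n /\ n <= m).
  { intros m Hm. destruct (Nat.lt_ge_cases m n) as [L|L].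
    - left. split; trivial. now apply Nat.mod_small.
    - right. split; trivial. replace m with ((m - n) + 1 * n) at 1 by lia.
      rewrite Nat.Div0.mod_add. apply Nat.mod_small. lia. }
  intros x y z E F.
  apply (f_equal (@proj1_sig _ _)) in E, F. simpl in E, F.
  pose proof (proj2_sig x) as Hx. pose proof (proj2_sig y) as Hy.
  pose proof (proj2_sig z) as Hz. simpl in Hx, Hy, Hz.
  assert (D : proj1_sig x = proj1_sig y \/ proj1_sig x = proj1_sig z \/
              proj1_sig y = proj1_sig z).
  { pose proof (K (proj1_sig x + proj1_sig x)). pose proof (K (proj1_sig y + proj1_sig y)).
    pose proof (K (proj1_sig z + proj1_sig z)). lia. }
  destruct D as [D|[D|D]]; apply cyc_vert_eq in D; auto.
Qed.

Lemma cyc_adjE (i j : cyc_group) :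
  cyc_adj n i j <-> (j = i + cyc_nat 1)%G \/ (i = j + cyc_nat 1)%G.
Proof.
  assert (K : forall i j : cyc_group, proj1_sig j = S (proj1_sig i) mod n <->
                (j = i + cyc_nat 1)%G).
  { clear i j. intros i j.
    assert (E : (i + cyc_nat 1)%G = cyc_of (S (proj1_sig i))).
    { rewrite <- (cyc_nat_val i) at 1. rewrite cyc_nat_add. now rewrite Nat.add_1_r. }
    rewrite E. split; [intros H; now apply cyc_vert_eq|now intros ->]. }
  unfold cyc_adj. now rewrite !K.
Qed.

(* Injectivity forbids turning back, so the image of an edge at [0] determines
   the whole map. *)
Lemma cyc_aut_walk (g : cyc_group -> cyc_group) (e : cyc_group) (f : nat -> cyc_group) :
  2 < n -> cyc_aut n g -> e = cyc_nat 1 \/ e = (- cyc_nat 1)%G ->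
  f 0 = 0%G -> (forall k, f (S k) = f k + e)%G ->
  g (cyc_nat 1) = (g 0 + e)%G -> forall k, g (cyc_nat k) = (g 0 + f k)%G.
Proof.
  intros H2 (Inj & _ & Adj) He F0 FS G1.
  change (forall x y : cyc_group, g x = g y -> x = y) in Inj.
  assert (K : forall k, g (cyc_nat k) = (g 0 + f k)%G /\
                        g (cyc_nat (S k)) = (g 0 + f (S k))%G).
  { induction k as [|k [IH0 IH1]].
    - split; [|rewrite FS, G1, F0; grp].
      rewrite F0. change (cyc_nat 0) with (0 : cyc_group)%G. grp.
    - split; trivial.
      assert (A1 : cyc_adj n (g (cyc_nat (S k))) (g (cyc_nat (S (S k))))).
      { apply Adj, cyc_adjE. left. rewrite cyc_nat_add. f_equal. lia. }
      assert (N : g (cyc_nat (S (S k))) <> g (cyc_nat k)).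
      { intros E%Inj.
        assert (E2 : cyc_nat 2 = 0%G).
        { rewrite <- (cyc_nat_add 2 k : _ = cyc_nat (S (S k))) in E. grp. }
        apply cyc_nat_eq0 in E2. apply Nat.divide_pos_le in E2; lia. }
      apply cyc_adjE in A1. pose proof (FS k) as E1. pose proof (FS (S k)) as E2.
      destruct A1 as [A1|A1], He as [He|He]; try grp; exfalso; apply N; grp. }
  intros k. apply K.
Qed.

Lemma cyc_aut_dihedral (g : cyc_group -> cyc_group) : 2 < n -> cyc_aut n g <->
  (exists s, forall u, g u = u + s)%G \/ (exists b, forall u, g u = b - u)%G.
Proof.
  intros H2. split.
  - intros G.
    (* The direction of the image of the edge from 0 to 1 decides between rotation and
       reflection. *)
    assert (A1 : cyc_adj n (g 0%G) (g (cyc_nat 1))).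
    { apply G, cyc_adjE. left. grp. }
    apply cyc_adjE in A1. destruct A1 as [A1|A1].
    + left. exists (g 0%G). intros u. rewrite <- (cyc_nat_val u).
      rewrite (cyc_aut_walk g (cyc_nat 1) cyc_nat); auto; [grp|].
      intros k. rewrite cyc_nat_add. f_equal. lia.
    + right. exists (g 0%G). intros u. rewrite <- (cyc_nat_val u).
      rewrite (cyc_aut_walk g (- cyc_nat 1)%G (fun k => - cyc_nat k)%G); auto.
      * change (cyc_nat 0) with (0 : cyc_group)%G. grp.
      * intros k. replace (cyc_nat (S k)) with (cyc_nat k + cyc_nat 1)%G; [grp|].
        rewrite cyc_nat_add. f_equal. lia.
      * grp.
  - intros D.
    enough (H : (forall u v : cyc_group, g u = g v -> u = v) /\
                (forall v : cyc_group, exists u : cyc_group, g u = v) /\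
                (forall u v : cyc_group, cyc_adj n (g u) (g v) <-> cyc_adj n u v))
      by exact H.
    destruct D as [(s & E)|(b & E)]; (split; [|split]).
    + intros u v H. rewrite !E in H. grp.
    + intros u. exists (u - s)%G. rewrite E. grp.
    + intros u v. rewrite !cyc_adjE, !E.
      split; (intros [H|H]; [left|right]; grp).
    + intros u v H. rewrite !E in H. grp.
    + intros u. exists (b - u)%G. rewrite E. grp.
    + intros u v. rewrite !cyc_adjE, !E.
      split; (intros [H|H]; [right|left]; grp).
Qed.

(** * Elements of order four and five in the cyclic group *)

Lemma cyc_no_four_torsion : ~ Nat.divide 4 n -> forall s, ~ four_torsion cyc_group s.
Proof.
  intros N s (H2 & H4). rewrite <- (cyc_nat_val s) in H2, H4.
  rewrite !cyc_nat_add, cyc_nat_eq0 in *. destruct H4 as [k Hk].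
  generalize dependent (proj1_sig s). intros v H2 Hk.
  (* From [4 * v = k * n]: an even [k] makes [n] divide [2 * v], and an odd [k] makes 4 divide
     [n]. *)
  destruct (Nat.Even_or_Odd k) as [[m Hm]|[m Hm]].
  - apply H2. exists m. subst k. lia.
  - assert (E : n mod 4 = 0 \/ n mod 4 = 1 \/ n mod 4 = 2 \/ n mod 4 = 3).
    { pose proof (Nat.mod_upper_bound n 4). lia. }
    pose proof (Nat.div_mod_eq n 4) as D.
    destruct E as [E|E]; [apply N; exists (n / 4); lia|].
    exfalso. set (q := n / 4) in *. clearbody q.
    assert (Hq : k * n = 4 * (k * q) + 2 * (m * (n mod 4)) + n mod 4) by (subst k; nia).
    destruct E as [E|[E|E]]; rewrite E in Hq; lia.
Qed.

Lemma cyc_no_five_torsion : ~ Nat.divide 5 n -> forall s, ~ five_torsion cyc_group s.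
Proof.
  intros N s (H1 & H5). rewrite <- (cyc_nat_val s) in H1, H5.
  rewrite !cyc_nat_add, cyc_nat_eq0 in *. destruct H5 as [k Hk].
  generalize dependent (proj1_sig s). intros v H1 Hk.
  (* In [5 * v = k * n] the factor 5 is prime and does not divide [n]; cancelling it will make [n]
     divide [v]. *)
  assert (G : Nat.divide 5 k).
  { apply Nat.gauss with n; [exists v; lia|].
    assert (D : Nat.divide (Nat.gcd 5 n) 5) by apply Nat.gcd_divide_l.
    assert (D' : Nat.divide (Nat.gcd 5 n) n) by apply Nat.gcd_divide_r.
    assert (B : Nat.gcd 5 n <= 5) by (apply Nat.divide_pos_le; [lia|trivial]).
    destruct D as [q Hq]. set (d := Nat.gcd 5 n) in *. clearbody d.
    destruct d as [|[|[|[|[|[|d]]]]]]; trivial; first [lia | contradiction]. }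
  destruct G as [q ->]. apply H1. exists q. nia.
Qed.
End Cycle.

(** * The unit circle *)

Section Circle.
Local Open Scope R_scope.

Definition re (p : S1) : R := fst (proj1_sig p).
Definition im (p : S1) : R := snd (proj1_sig p).

Lemma S1_unit p : re p ^ 2 + im p ^ 2 = 1.
Proof. exact (proj2_sig p). Qed.

Lemma S1_eq p q : re p = re q -> im p = im q -> p = q.
Proof.
  destruct p as [[a b] Hp], q as [[a' b'] Hq]; unfold re, im; simpl.
  intros -> ->. f_equal. apply proof_irrelevance.
Qed.

Lemma S1_dist2E p q : S1_dist2 p q = (re p - re q) ^ 2 + (im p - im q) ^ 2.
Proof. now destruct p, q. Qed.

Definition S1_zero : S1.
Proof. exists (1, 0). simpl. ring. Defined.

(** Complex multiplication, written additively; the inverse is conjugation. *)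
Definition S1_add (p q : S1) : S1.
Proof.
  exists (re p * re q - im p * im q, re p * im q + im p * re q).
  pose proof (S1_unit p) as Hp. pose proof (S1_unit q) as Hq. simpl fst; simpl snd.
  transitivity ((re p ^ 2 + im p ^ 2) * (re q ^ 2 + im q ^ 2)); [ring|].
  rewrite Hp, Hq. ring.
Defined.

Definition S1_opp (p : S1) : S1.
Proof.
  exists (re p, - im p). pose proof (S1_unit p) as Hp. simpl fst; simpl snd.
  rewrite <- Hp. ring.
Defined.

Lemma re_add p q : re (S1_add p q) = re p * re q - im p * im q.
Proof. reflexivity. Qed.

Lemma im_add p q : im (S1_add p q) = re p * im q + im p * re q.
Proof. reflexivity. Qed.

Lemma re_opp p : re (S1_opp p) = re p.
Proof. reflexivity. Qed.

Lemma im_opp p : im (S1_opp p) = - im p.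
Proof. reflexivity. Qed.

Lemma re_zero : re S1_zero = 1.
Proof. reflexivity. Qed.

Lemma im_zero : im S1_zero = 0.
Proof. reflexivity. Qed.

Lemma S1_addA p q r : S1_add p (S1_add q r) = S1_add (S1_add p q) r.
Proof. apply S1_eq; rewrite ?re_add, ?im_add, ?re_add, ?im_add; ring. Qed.

Lemma S1_addC p q : S1_add p q = S1_add q p.
Proof. apply S1_eq; rewrite ?re_add, ?im_add; ring. Qed.

Lemma S1_add0 p : S1_add p S1_zero = p.
Proof. apply S1_eq; rewrite ?re_add, ?im_add, re_zero, im_zero; ring. Qed.

Lemma S1_addN p : S1_add p (S1_opp p) = S1_zero.
Proof.
  apply S1_eq; rewrite ?re_add, ?im_add, re_opp, im_opp, ?re_zero, ?im_zero; [|ring].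
  rewrite <- (S1_unit p). ring.
Qed.

Definition S1_group : abgroup :=
  AbGroup S1 S1_zero S1_add S1_opp S1_addA S1_addC S1_add0 S1_addN.

(** Only 1 and -1 have square 1. If neither [x - y] nor [x - z] is the unit, both are -1 and
    [y = z]. *)
Lemma S1_two_torsion : two_torsion_small S1_group.
Proof.
  assert (K : forall u : S1_group, (u + u)%G = 0%G -> im u = 0 /\ (re u = 1 \/ re u = -1)).
  { intros u H. pose proof (S1_unit u) as Hu.
    apply (f_equal re) in H. change (re u * re u - im u * im u = 1) in H.
    assert (I : im u = 0) by nra. split; trivial.
    rewrite I in *. assert (E : (re u - 1) * (re u + 1) = 0) by lra.
    apply Rmult_integral in E. lra. }
  intros x y z E F.
  destruct (K (x - y)%G) as [I1 R1]; [grp|]. destruct (K (x - z)%G) as [I2 R2]; [grp|].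
  assert (Z : forall u v : S1_group, re u = re v -> im u = im v -> u = v) by exact S1_eq.
  destruct R1 as [R1|R1].
  { left. assert ((x - y)%G = 0%G) by now apply Z. grp. }
  destruct R2 as [R2|R2].
  { right; left. assert ((x - z)%G = 0%G) by now apply Z. grp. }
  right; right. assert ((x - y)%G = (x - z)%G) by (apply Z; congruence). grp.
Qed.

Lemma S1_dist2_rot p q s : S1_dist2 (S1_add p s) (S1_add q s) = S1_dist2 p q.
Proof.
  rewrite !S1_dist2E, !re_add, !im_add.
  transitivity ((re s ^ 2 + im s ^ 2) * ((re p - re q) ^ 2 + (im p - im q) ^ 2)); [ring|].
  rewrite S1_unit. ring.
Qed.

Lemma S1_dist2_opp p q : S1_dist2 (S1_opp p) (S1_opp q) = S1_dist2 p q.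
Proof. rewrite !S1_dist2E, !re_opp, !im_opp. ring. Qed.

Definition S1_i : S1.
Proof. exists (0, 1). simpl. ring. Defined.

(** Distances between unit vectors determine their inner products. Pairing with [S1_zero] shows that
    real parts are kept; pairing with [S1_i] shows that imaginary parts all change by the same
    sign. *)
Lemma S1_isom_fix (f : S1 -> S1) :
  (forall p q, S1_dist2 (f p) (f q) = S1_dist2 p q) -> f S1_zero = S1_zero ->
  (forall p, f p = p) \/ (forall p, f p = S1_opp p).
Proof.
  intros D F0.
  assert (I : forall p q, re (f p) * re (f q) + im (f p) * im (f q) =
                          re p * re q + im p * im q).
  { intros p q. pose proof (D p q) as E. rewrite !S1_dist2E in E.
    pose proof (S1_unit p). pose proof (S1_unit q).
    pose proof (S1_unit (f p)). pose proof (S1_unit (f q)). nra. }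
  assert (X : forall p, re (f p) = re p).
  { intros p. pose proof (I p S1_zero) as E. rewrite F0, re_zero, im_zero in E. lra. }
  assert (J : im (f S1_i) = 1 \/ im (f S1_i) = -1).
  { pose proof (S1_unit (f S1_i)) as E. rewrite X in E.
    change (re S1_i) with 0 in E.
    assert (E' : (im (f S1_i) - 1) * (im (f S1_i) + 1) = 0) by lra.
    apply Rmult_integral in E'. lra. }
  assert (Y : forall p, im (f p) * im (f S1_i) = im p).
  { intros p. pose proof (I p S1_i) as E. rewrite (X S1_i) in E.
    change (re S1_i) with 0 in E. change (im S1_i) with 1 in E. lra. }
  destruct J as [J|J]; [left|right]; intros p; pose proof (Y p) as E; rewrite J in E;
    apply S1_eq; rewrite ?re_opp, ?im_opp, ?X; lra.
Qed.

Lemma S1_isom_dihedral (g : S1_group -> S1_group) : S1_isom g <->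
  (exists s, forall u, g u = u + s)%G \/ (exists b, forall u, g u = b - u)%G.
Proof.
  split.
  - intros [D _].
    (* Rotating back by [g 0] gives an isometry that fixes the unit. *)
    destruct (S1_isom_fix (fun p => (g p - g 0)%G)) as [F|F].
    + intros p q. rewrite <- (D p q). apply S1_dist2_rot.
    + apply S1_addN.
    + left. exists (g 0%G). intros u. pose proof (F u : (g u - g 0)%G = u). grp.
    + right. exists (g 0%G). intros u. pose proof (F u : (g u - g 0 = - u)%G). grp.
  - intros D.
    enough (H : (forall p q : S1_group, S1_dist2 (g p) (g q) = S1_dist2 p q) /\
                (forall v : S1_group, exists u : S1_group, g u = v)) by exact H.
    destruct D as [(s & E)|(b & E)]; split.
    + intros p q. rewrite !E. apply S1_dist2_rot.
    + intros u. exists (u - s)%G. rewrite E. grp.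
    + intros p q. rewrite !E, !(gaddC _ b).
      exact (eq_trans (S1_dist2_rot _ _ _) (S1_dist2_opp _ _)).
    + intros u. exists (b - u)%G. rewrite E. grp.
Qed.

(** * Angles and an element of order five on the circle *)

Definition S1_angle (t : R) : S1_group.
Proof.
  exists (cos t, sin t). simpl fst; simpl snd.
  rewrite <- (sin2_cos2 t). unfold Rsqr. ring.
Defined.

Lemma S1_angle_add s t : (S1_angle s + S1_angle t)%G = S1_angle (s + t).
Proof.
  apply S1_eq.
  - symmetry. apply cos_plus.
  - change (cos s * sin t + sin s * cos t = sin (s + t)). rewrite sin_plus. ring.
Qed.

Lemma S1_five_torsion : five_torsion S1_group (S1_angle (2 * PI / 5)).
Proof.
  pose proof PI_RGT_0 as Pi. split.
  - intros E. apply (f_equal im) in E. change (sin (2 * PI / 5) = 0) in E.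
    assert (0 < sin (2 * PI / 5)) by (apply sin_gt_0; lra). lra.
  - rewrite !S1_angle_add.
    replace (_ + _) with (2 * PI) by field.
    apply S1_eq; [apply cos_2PI|apply sin_2PI].
Qed.
End Circle.

Theorem theorem1 :
  (forall n : nat, 6 <= n -> ~ Nat.divide 4 n -> ~ Nat.divide 5 n ->
     ext_D_eq (cyc_vert n) (cyc_aut n) 4) /\
  (forall n : nat, 6 <= n -> Nat.divide 4 n -> ~ Nat.divide 5 n ->
     ext_D_eq (cyc_vert n) (cyc_aut n) 5) /\
  (forall n : nat, 6 <= n -> Nat.divide 5 n ->
     ext_D_eq (cyc_vert n) (cyc_aut n) 6) /\
  ext_D_eq S1 S1_isom 6.
Proof.
  assert (Small : forall (n : nat) (Hn : 0 < n) k, 0 < k < n -> cyc_nat n Hn k <> 0%G).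
  { intros n Hn k Hk E. apply cyc_nat_eq0 in E. apply Nat.divide_pos_le in E; lia. }
  assert (Zero : forall (n : nat) (Hn : 0 < n) k, k = n -> cyc_nat n Hn k = 0%G).
  { intros n Hn k ->. apply cyc_nat_eq0, Nat.divide_refl. }
  assert (Dih : forall (n : nat) (Hn : 0 < n), 6 <= n -> forall g, cyc_aut n g <->
    (exists s, forall u, g u = gadd (A := cyc_group n Hn) u s) \/
    (exists b, forall u, g u = gadd (A := cyc_group n Hn) b (gopp (A := cyc_group n Hn) u))).
  { intros n Hn H6 g. apply (cyc_aut_dihedral n Hn). lia. }
  split; [|split; [|split]].
  - intros n H6 N4 N5. assert (Hn : 0 < n) by lia.
    apply (ext_D_four (cyc_group n Hn) (cyc_aut n) (Dih n Hn H6)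
             (cyc_two_torsion n Hn) (cyc_nat n Hn 1)).
    + rewrite cyc_nat_add. apply Small. lia.
    + now apply cyc_no_four_torsion.
    + now apply cyc_no_five_torsion.
  - intros n H6 [q Hq] N5. assert (Hn : 0 < n) by lia.
    (* With [n = q * 4], the vertex [q] has order four. *)
    apply (ext_D_five (cyc_group n Hn) (cyc_aut n) (Dih n Hn H6)
             (cyc_two_torsion n Hn) (cyc_nat n Hn q)).
    + split; rewrite !cyc_nat_add; [apply Small|apply Zero]; lia.
    + now apply cyc_no_five_torsion.
  - intros n H6 [q Hq]. assert (Hn : 0 < n) by lia.
    (* With [n = q * 5], the vertex [q] has order five. *)
    apply (ext_D_six (cyc_group n Hn) (cyc_aut n) (Dih n Hn H6)
             (cyc_two_torsion n Hn) (cyc_nat n Hn q)).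
    split; rewrite ?cyc_nat_add; [apply Small|apply Zero]; lia.
  - exact (ext_D_six S1_group S1_isom S1_isom_dihedral S1_two_torsion _ S1_five_torsion).
Qed.
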